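(* Let $X$ be a locally compact, separable, completely metrizable topological space and let $\mathcal{P}$ be a closed set (in the closed convergence topology) of locally strict preferences on $X$. Let $\lambda$ be a Borel probability measure on $X$ with full support such that, for all $\succeq\,\in\mathcal{P}$, the set $\{(x,y):x\sim y\}$ has $\lambda\otimes\lambda$-probability $0$, and let $q$ be an error probability function. If $\mathcal{P}$ has finite VC dimension, then, as $\eta\to0$ and $\delta\to0$, $$N(\eta,\delta)=O\!\left(\frac{1}{r(\eta)^2}\ln\frac1\delta\right).$$
   Context: A preference on $X$ is a binary relation $\succeq\,\subseteq X\times X$ that is complete and continuous (closed in $X\times X$); transitivity is not required. $x\succ y$ means $x\succeq y$ and not $y\succeq x$; $x\sim y$ means $x\succeq y$ and $y\succeq x$. $\succeq$ is locally strict if for all $x\succeq y$ and every neighborhood $V$ of $(x,y)$ in $X\times X$ there is $(x',y')\in V$ with $x'\succ y'$. Closed convergence: $\succeq_n\to\succeq^*$ means (1) for all $x^*\succeq^* y^*$ there are $(x_n,y_n)\to(x^*,y^* )$ with $x_n\succeq_n y_n$ for all $n$; and (2) for every subsequence $\{\succeq_{n_k}\}_k$ and every limit $(x^*,y^* )$ of pairs with $x_{n_k}\succeq_{n_k}y_{n_k}$ for all $k$, $x^*\succeq^*y^*$. For $X$ as in the claim, this is convergence in the (metrizable) closed convergence topology on continuous binary relations (closed subsets of $X\times X$). $\rho$ is a fixed metric compatible with this topology. An error probability function is $q:\mathcal{P}\times X\times X\to[0,1]$ such that $q(\succeq;\cdot,\cdot)$ is measurable for each $\succeq\,\in\mathcal{P}$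 and $x\succ y$ implies $q(\succeq;x,y)>1/2$. A subject with preference $\succeq$ facing $\{x,y\}$ chooses $x$ with probability $q(\succeq;x,y)$ and $y$ with the complementary probability (so $q(\succeq;y,x)=1-q(\succeq;x,y)$ for $x\ne y$). The experiment $\Sigma_n=\{B_1,\dots,B_n\}$ consists of problems $B_k=\{x_k,y_k\}$ where all $x_k,y_k$ are drawn i.i.d. from $\lambda$; the choices of a subject with preference $\succeq^*\in\mathcal{P}$ are drawn, independently across problems, according to $q(\succeq^*;\cdot,\cdot)$. $R_n$ is the set of $(x,y)$ with $\{x,y\}\in\Sigma_n$ and $x$ chosen from $\{x,y\}$. The Kemeny-minimizing estimator $\succeq_n$ is any element of $\arg\min\{\frac1n|R_n\setminus\succeq|:\succeq\,\in\mathcal{P}\}$. For $\eta>0$, $\delta\in(0,1)$, $N(\eta,\delta)$ is the smallest $N$ such that for all $n\ge N$ and all subject preferences $\succeq^*\in\mathcal{P}$, $\Pr(\rho(\succeq_n,\succeq^* )<\eta)\ge1-\delta$ ($N(\eta,\delta)=\infty$ if there is none). For Borel $A\subseteq X\times X$, $\mu(A,\succeq^* )=\int_A q(\succeq^*;x,y)\,d(\lambda\otimes\lambda)(x,y)$, and $$r(\eta)=\inf\{\mu(\succeq^*,\succeq^* )-\mu(\succeq,\succeq^* ):\ \succeq,\succeq^*\in\mathcal{P},\ \rho(\succeq^*,\succeq)\ge\eta\}.$$ The bound is vacuous when $r(\eta)=0$. VC dimension of $\mathcal{P}$: let $S_n$ be the largest cardinality of $\{(\mathbf 1_{x_1\succeq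 y_1},\dots,\mathbf 1_{x_n\succeq y_n})\in\{0,1\}^n:\succeq\,\in\mathcal{P}\}$ over all $x_k,y_k\in X$, $k=1,\dots,n$. The VC dimension is the maximum $n$ with $S_n=2^n$ (infinite if there is no maximum). The big-$O$ statement means there are constants $K,\eta_0,\delta_0>0$ with $N(\eta,\delta)\le K\,r(\eta)^{-2}\ln(1/\delta)$ for all $0<\eta<\eta_0$, $0<\delta<\delta_0$. *)

(* Defs.v *)
From HB Require Import structures.
From mathcomp Require Import all_boot all_order all_algebra finmap.
From mathcomp Require Import all_classical all_reals all_analysis.
Import Order.TTheory GRing.Theory Num.Theory.
Import numFieldNormedType.Exports.

Set Implicit Arguments.
Unset Strict Implicit.
Unset Printing Implicit Defensive.

Local Open Scope classical_set_scope.
Local Open Scope ring_scope.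

Section Metrics.
Context {R : realType}.

Definition metric_on (T : Type) (D : set T) (d : T -> T -> R) : Prop :=
  [/\ forall a b, D a -> D b -> 0 <= d a b,
      forall a b, D a -> D b -> (d a b = 0 <-> a = b),
      forall a b, D a -> D b -> d a b = d b a
    & forall a b c, D a -> D b -> D c -> d a c <= d a b + d b c].

Definition complete_metric (T : topologicalType) (d : T -> T -> R) : Prop :=
  forall u : nat -> T,
    (forall e : R, 0 < e ->
       exists N, forall m n, (N <= m)%N -> (N <= n)%N -> d (u m) (u n) < e) ->
    exists l : T, u @ \oo --> l.

End Metrics.

Definition completely_metrizable (R : realType) (X : topologicalType) : Prop :=
  exists d : X -> X -> R,
    [/\ metric_on [set: X] d,
        forall x (A : set X),
          nbhs x A <-> exists2 e : R, 0 < e & forall y, d x y < e -> A y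
      & complete_metric d].

Definition separable (X : topologicalType) : Prop :=
  exists2 D : set X, countable D & dense D.

(* [X] equipped with its Borel sigma-algebra. On [borel X * borel X] the
   library puts the product sigma-algebra, which is the Borel sigma-algebra of
   [X * X] when [X] is second countable, e.g. separable and metrizable. *)
Notation borel X := (g_sigma_algebraType (@open X)).

(** A binary relation is the set of the pairs [(x, y)] such that [x] is weakly
    preferred to [y]. *)
Section Preferences.
Context {X : topologicalType}.
Implicit Types (P : set (X * X)) (PP : set (set (X * X))).

Definition preference P : Prop :=
  (forall x y, P (x, y) \/ P (y, x)) /\ closed P.

Definition strictly P (x y : X) : Prop := P (x, y) /\ ~ P (y, x).

Definition indifference P : set (X * X) :=
  [set z | P (z.1, z.2) /\ P (z.2, z.1)].

Definition locally_strict P : Prop :=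
  forall x y, P (x, y) -> forall V : set (X * X), nbhs (x, y) V ->
    exists x' y', V (x', y') /\ strictly P x' y'.

Definition closed_convergence (u : nat -> set (X * X)) P : Prop :=
  (forall z, P z ->
     exists w : nat -> X * X, w @ \oo --> z /\ forall n, u n (w n)) /\
  (forall k : nat -> nat, increasing_seq k ->
     forall (w : nat -> X * X) z,
       (forall j, u (k j) (w j)) -> w @ \oo --> z -> P z).

(* The closed convergence topology is metrizable, so closed sets are the
   sequentially closed ones. *)
Definition closed_in_closed_convergence PP : Prop :=
  forall (u : nat -> set (X * X)) P,
    (forall n, PP (u n)) -> closed_convergence u P -> PP P.

(* [rho] metrizes closed convergence. It is a metric on preferences only:
   requiring [w n \in u n] for all [n] in [closed_convergence] is not a
   topological notion on a class that also contains the empty relation. *)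
Definition compatible_metric {R : realType}
    (rho : set (X * X) -> set (X * X) -> R) : Prop :=
  metric_on preference rho /\
  forall (u : nat -> set (X * X)) P,
    (forall n, preference (u n)) -> preference P ->
    (closed_convergence u P <-> rho (u n) P @[n --> \oo] --> (0 : R)).

Definition traces PP n (z : 'I_n -> X * X) : {set {ffun 'I_n -> bool}} :=
  [set f : {ffun 'I_n -> bool} |
     `[< exists2 P, PP P & forall k, f k = `[< P (z k) >] >]]%SET.

(* The bound [(2 ^ n).+1] on the index loses nothing, since
   [#|{ffun 'I_n -> bool}| = 2 ^ n]. *)
Definition shatter_coefficient PP n : nat :=
  \max_(s < (2 ^ n).+1 | `[< exists z, #|@traces PP n z| = s >]) s.

Definition is_VC_dimension PP (v : nat) : Prop :=
  shatter_coefficient PP v = (2 ^ v)%N /\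
  forall n, shatter_coefficient PP n = (2 ^ n)%N -> (n <= v)%N.

Definition finite_VC_dimension PP : Prop := exists v, is_VC_dimension PP v.

End Preferences.

Section Model.
Context {R : realType} {X : ptopologicalType}.
Variables (PP : set (set (X * X))) (lambda : probability (borel X) R).
Variable q : set (X * X) -> X * X -> R.

Definition full_support : Prop :=
  forall U : set X, open U -> U !=set0 -> (0 < lambda U)%E.

Definition error_probability : Prop :=
  forall P, PP P ->
    [/\ measurable_fun [set: borel X * borel X] (q P : borel X * borel X -> R),
        forall z, 0 <= q P z <= 1,
        forall x y, strictly P x y -> 2^-1 < q P (x, y)
      & forall x y, x <> y -> q P (y, x) = 1 - q P (x, y)].

Definition mu (A P : set (X * X)) : \bar R :=
  (\int[lambda \x lambda]_(z in A) (q P z)%:E)%E.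

(* In [\bar R], so that the infimum of the empty set is [+oo]. *)
Definition rfun (rho : set (X * X) -> set (X * X) -> R) (eta : R) : \bar R :=
  ereal_inf [set v | exists P Ps : set (X * X),
    [/\ PP P, PP Ps, eta <= rho Ps P & v = (mu Ps Ps - mu P Ps)%E]].

Context {d : measure_display} {Omega : measurableType d}.
Variable Pr : set (X * X) -> probability Omega R.
Variables (x y : nat -> Omega -> X) (c : nat -> Omega -> bool).

(* [Pr P] is the law of the experiment for a subject with preference [P]; the
   [k]-th problem is [{x k, y k}], and [c k] tells that [x k] is chosen. The
   triples [(x k, y k, c k)] are independent across [k], the pair [(x k, y k)]
   has law [lambda \x lambda], and given this pair [x k] is chosen with
   probability [q P (x k, y k)]. *)
Definition experiment : Prop :=
  [/\ forall k, measurable_fun [set: Omega] (x k : Omega -> borel X),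
      forall k, measurable_fun [set: Omega] (y k : Omega -> borel X),
      forall k, measurable_fun [set: Omega] (c k)
    & forall P, PP P ->
      forall n (D : 'I_n -> set (borel X * borel X)) (b : 'I_n -> bool),
        (forall k, measurable (D k)) ->
        Pr P [set w | forall k : 'I_n, D k (x k w, y k w) /\ c k w = b k] =
        (\prod_(k < n) \int[lambda \x lambda]_(z in D k)
           (if b k then q P z else 1 - q P z)%:E)%E].

Definition chosen_pair (w : Omega) (k : nat) : X * X :=
  if c k w then (x k w, y k w) else (y k w, x k w).

Definition chosen (n : nat) (w : Omega) : {fset X * X} :=
  seq_fset tt [seq chosen_pair w k | k <- iota 0 n].

Definition kemeny_loss (n : nat) (w : Omega) (P : set (X * X)) : R :=
  n%:R^-1 * #|` [fset z in chosen n w | ~~ `[< P z >]]%fset |%:R.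

Definition kemeny_minimizer (n : nat) (w : Omega) (P : set (X * X)) : Prop :=
  PP P /\ forall P', PP P' -> kemeny_loss n w P <= kemeny_loss n w P'.

Definition kemeny_estimator (est : nat -> Omega -> set (X * X)) : Prop :=
  forall n w, kemeny_minimizer n w (est n w).

End Model.
Arguments kemeny_estimator R {X} PP {d Omega} x y c est.

(* The estimator is an arbitrary selection from the argmin, so that the event
   that it is close to the truth need not be measurable. *)
Definition inner_probability {R : realType} {d : measure_display}
    {Omega : measurableType d} (Q : probability Omega R) (E : set Omega)
    : \bar R :=
  ereal_sup [set Q F | F in [set F | measurable F /\ F `<=` E]].

Lemma inner_probabilityE {R : realType} {d : measure_display}
    {Omega : measurableType d} (Q : probability Omega R) (E : set Omega) :
  measurable E -> inner_probability Q E = Q E.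
Proof.
move=> mE; apply/eqP; rewrite eq_le; apply/andP; split.
  apply: ge_ereal_sup => _ [F [mF FE] <-].
  by apply: le_measure FE; rewrite inE.
by apply: ereal_sup_ubound; exists E => //; split.
Qed.

(* Ranges over [N >= 0]; equals [+oo] if there is no such [N]. *)
Definition sample_size {R : realType} {X : ptopologicalType}
    {d : measure_display} {Omega : measurableType d}
    (PP : set (set (X * X))) (rho : set (X * X) -> set (X * X) -> R)
    (Pr : set (X * X) -> probability Omega R)
    (est : nat -> Omega -> set (X * X)) (eta delta : R) : \bar R :=
  ereal_inf [set N%:R%:E | N in [set N : nat |
    forall n, (N <= n)%N -> forall Ps, PP Ps ->
      ((1 - delta)%:E <=
       inner_probability (Pr Ps) [set w | (rho (est n w) Ps < eta)%R])%E]].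

(* Main.v *)
Require Import Defs.
From mathcomp Require Import all_boot all_order all_algebra.
From mathcomp Require Import reals sequences exp.
From mathcomp Require Import ring lra zify.
Import Order.TTheory GRing.Theory Num.Theory.
Local Open Scope ring_scope.
Set Implicit Arguments.
Unset Strict Implicit.
Unset Printing Implicit Defensive.

(** Let [Z_k] be the ordered pair (chosen, rejected) of the [k]-th problem. Its
    law [nu] satisfies [nu(P) = 2 mu(P, Ps)], and a Kemeny minimizer maximizes
    the empirical frequency of [Z_k \in P], because the indifference sets, hence
    the diagonal, are null, so that almost surely no pair is drawn twice. If the
    estimator is [eta]-far from the truth [Ps], then some [P] with
    [nu(P) <= nu(Ps) - 2 r(eta)] is at least as frequent as [Ps] in the sample.
    This has probability at most [2 exp(- n r^2 / 1088)] once [n r^2] exceeds a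
    constant depending only on the VC dimension: one compares with a ghost sample,
    swaps the two samples at random, and, for fixed samples, chains over Hamming
    nets of the traces, whose sizes are controlled by Sauer-Shelah and Dudley's
    packing argument. Chaining is needed because a union bound over all traces
    costs a factor [ln (1 / r)].

    Uncountable unions over preferences are measurable since closed sets are
    sequentially compact for closed convergence: the set of samples with a given
    trace of some preference of a closed class is obtained from boxes of basic
    open sets by countable operations. *)

(** * Sub-Gaussian tails and Sauer-Shelah *)

(** The estimator depends on the data, so deviations must be controlled uniformly over a possibly
    infinite class; after the swap both samples are fixed and only finitely many traces on [2 n]
    points remain. The net sizes involve a constant depending on the VC dimension alone, so the
    requirement [B <= n r^2] is met at the price of a constant factor as soon as
    [ln (1 / delta) >= 1]. Hence the choice [delta0 = exp (- 1)], and the absence of a separate VC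
    term in the bound. The constant is [1088 = 2 * 8 * 68]: [8] is the constant of the tail bound
    for random signs, [68] that of the variance of one chaining increment, and the factor [2]
    reserves half of the exponent to pay for the number of links. The estimator may fail to be
    measurable, so its good event is bounded from inside by a measurable one: the samples without
    repetition on which every far preference is strictly less frequent than the truth. *)

Lemma cosh_le_expR_sqr {R : realType} (x : R) :
  expR x + expR (- x) <= 2 * expR (2 * x ^+ 2).
Proof.
wlog x0 : x / 0 <= x => [hw|].
  case: (leP 0 x) => [/hw//|xlt0].
  by have := hw (- x); rewrite opprK sqrrN addrC; apply; lra.
have e1 := expR_ge1Dx (2 * x ^+ 2).
case: (leP x 1) => x1; last first.
  have : expR x <= expR (2 * x ^+ 2) by rewrite ler_expR; nra.
  have : expR (- x) <= expR x by rewrite ler_expR; lra.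
  lra.
(* With [a = exp y], [b = exp (- y)] and [a b = 1], the left side minus [2] is [(a - b)^2 <= 9 y^2],
   while [1 + 2 x^2 <= exp (2 x^2)] leaves room for [16 y^2]. *)
pose y := x / 2.
have -> : x = y + y by rewrite /y; lra.
have y0 : 0 <= y by rewrite /y; lra.
have y1 : y <= 2^-1 by rewrite /y; lra.
rewrite opprD !expRD.
have ab : expR y * expR (- y) = 1 by rewrite -expRD subrr expR0.
have b1 := expR_ge1Dx (- y); have a1 := expR_ge1Dx y.
have := expR_ge1Dx (2 * (y + y) ^+ 2).
set a := expR y in ab a1 *; set b := expR (- y) in ab b1 *; set E := expR _.
move=> hE.
have d0 : 0 <= a - b by nra.
have d1 : a - b <= 3 * y by nra.
have : (a - b) ^+ 2 <= (3 * y) ^+ 2 by rewrite !expr2; apply: ler_pM.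
nra.
Qed.

(** Chernoff's bound by counting: the exponential sum over sign vectors factors over [J], and
    [u = t / (4 W)] minimizes [2 u^2 W - u t]. *)
Lemma rademacher_tail {R : realType} (J : finType) (a : J -> R) (W t : R) :
  0 < W -> \sum_j a j ^+ 2 <= W -> 0 <= t ->
  #|[set s : {ffun J -> bool} | t <= \sum_j (-1) ^+ s j * a j]%SET|%:R <=
  2 ^+ #|J| * expR (- (t ^+ 2 / (8 * W))).
Proof.
move=> W0 aW t0; set S := [set _ | _]%SET.
pose u := t / (4 * W).
have u0 : 0 <= u by rewrite /u divr_ge0// mulr_ge0// ltW.
have mgf : \sum_(s : {ffun J -> bool}) expR (u * \sum_j (-1) ^+ s j * a j) <=
    2 ^+ #|J| * expR (2 * u ^+ 2 * W).
  under eq_bigr do rewrite big_distrr /= expR_sum.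
  rewrite -(bigA_distr_bigA (fun j (b : bool) => expR (u * ((-1) ^+ b * a j)))) /=.
  apply: (@le_trans _ _ (\prod_j (2 * expR (2 * u ^+ 2 * a j ^+ 2)))).
    apply: ler_prod => j _; rewrite sumr_ge0/=; last by move=> *; exact: expR_ge0.
    rewrite big_bool /= expr1 expr0 mul1r mulN1r mulrN addrC.
    by rewrite -mulrA -exprMn cosh_le_expR_sqr.
  rewrite big_split /= prodr_const ler_pM2l ?exprn_gt0//.
  rewrite -expR_sum ler_expR -big_distrr /=.
  by apply: ler_wpM2l => //; rewrite mulr_ge0// sqr_ge0.
have card : #|S|%:R * expR (u * t) <=
    \sum_(s : {ffun J -> bool}) expR (u * \sum_j (-1) ^+ s j * a j).
  rewrite mulr_natl -sumr_const [leRHS](bigID (fun s => s \in S)) /=.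
  rewrite -[leLHS]addr0; apply: lerD; last by apply: sumr_ge0 => *; exact: expR_ge0.
  by apply: ler_sum => s; rewrite inE => ts; rewrite ler_expR ler_wpM2l.
have -> : - (t ^+ 2 / (8 * W)) = 2 * u ^+ 2 * W - u * t.
  by rewrite /u; field; rewrite gt_eqF.
by rewrite expRD mulrA expRN -ler_pdivrMr ?invr_gt0 ?expR_gt0// invrK (le_trans card).
Qed.

Definition shatters (T : finType) (F : {set {set T}}) (S : {set T}) :=
  [forall B : {set T}, (B \subset S) ==> [exists f in F, f :&: S == B]].

Lemma shattersP (T : finType) (F : {set {set T}}) (S : {set T}) :
  reflect (forall B : {set T}, B \subset S -> exists2 f, f \in F & f :&: S = B)
          (shatters F S).
Proof.
apply: (iffP forallP) => h B.
  move=> BS; have /implyP/(_ BS)/existsP[f /andP[fF /eqP fB]] := h B.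
  by exists f.
apply/implyP => /h[f fF fB]; apply/existsP; exists f.
by rewrite fF fB eqxx.
Qed.

(** Induction on [A], removing a point [a]: [F] splits into [F0], the members avoiding [a], and
    [F1], the others with [a] deleted. [F] shatters whatever either part shatters, and when both
    parts shatter [S] it also shatters [a |: S]; these extra sets contain [a], hence are new. *)
Lemma pajor (T : finType) (A : {set T}) (F : {set {set T}}) :
  F \subset powerset A ->
  (#|F| <= #|[set S in powerset A | shatters F S]%SET|)%N.
Proof.
move: {2}#|A| (leqnn #|A|) => n; elim: n A F => [|n IH] A F.
  rewrite leqn0 cards_eq0 => /eqP -> FA.
  case: (set_0Vmem F) => [->|[f fF]]; first by rewrite cards0.
  have f0 : f = set0 by apply/eqP; rewrite -subset0 -powersetE (subsetP FA).
  apply: (@leq_trans 1).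
    by rewrite -(cards1 (set0 : {set T})) -powerset0 subset_leq_card.
  rewrite card_gt0; apply/set0Pn; exists set0.
  rewrite !inE subxx; apply/shattersP => B; rewrite subset0 => /eqP ->.
  by exists f => //; rewrite setI0.
move=> cA FA; case: (set_0Vmem A) => [A0|[a aA]].
  by apply: IH => //; rewrite A0 cards0.
pose A' := A :\ a.
have cA' : (#|A'| <= n)%N by move: cA; rewrite (cardsD1 a) aA add1n ltnS.
pose F0 := [set f in F | a \notin f]%SET.
pose F1 := [set (f :\ a)%SET | f in [set f in F | a \in f]%SET]%SET.
have F0A : F0 \subset powerset A'.
  apply/subsetP => f; rewrite !inE => /andP[/(subsetP FA)]; rewrite !inE => fA af.
  by rewrite subsetD1 fA.
have F1A : F1 \subset powerset A'.
  apply/subsetP => _ /imsetP[f + ->]; rewrite !inE => /andP[/(subsetP FA)].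
  by rewrite !inE => fA af; rewrite setSD.
have cF : #|F| = (#|F0| + #|F1|)%N.
  rewrite card_in_imset; last first.
    move=> f g; rewrite !inE => /andP[_ af] /andP[_ ag] fg.
    by rewrite -(setD1K af) -(setD1K ag) fg.
  rewrite addnC -(cardsID [set f : {set T} | a \in f]%SET F); congr addn.
    by apply: eq_card => f; rewrite !inE.
  by apply: eq_card => f; rewrite !inE andbC.
pose S0 := [set S in powerset A' | shatters F0 S]%SET.
pose S1 := [set S in powerset A' | shatters F1 S]%SET.
rewrite cF; apply: (leq_trans (leq_add (IH _ _ cA' F0A) (IH _ _ cA' F1A))).
rewrite -/S0 -/S1 -cardsUI.
have notin S : S \in S0 :|: S1 -> (S \subset A) /\ a \notin S.
  rewrite !inE -andb_orr => /andP[+ _].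
  by rewrite subsetD1 => /andP[].
pose G := [set (a |: S)%SET | S in S0 :&: S1]%SET.
have cG : #|S0 :&: S1| = #|G|.
  rewrite card_in_imset// => S S' SI SI' e.
  have [_ aS] := notin S (subsetP (subset_trans (subsetIl _ _) (subsetUl _ _)) _ SI).
  have [_ aS'] := notin S' (subsetP (subset_trans (subsetIl _ _) (subsetUl _ _)) _ SI').
  by rewrite -(setU1K aS) -(setU1K aS') e.
rewrite cG -cardsUI.
have -> : (S0 :|: S1) :&: G = set0.
  apply/eqP; rewrite -subset0; apply/subsetP => S; rewrite inE => /andP[/notin[_ aS]].
  by move=> /imsetP[S' _ e]; move: aS; rewrite e !inE eqxx.
rewrite cards0 addn0; apply: subset_leq_card; apply/subsetP => S.
rewrite in_setU => /orP[SU|].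
  have [SA aS] := notin _ SU; rewrite !inE SA /=.
  move: SU; rewrite !inE -andb_orr => /andP[_ /orP[]] /shattersP sh; apply/shattersP.
    by move=> B /sh[f + fB]; rewrite inE => /andP[fF _]; exists f.
  move=> B /sh[_ /imsetP[f + ->] fB]; rewrite inE => /andP[fF _]; exists f => //.
  rewrite -fB; apply/setP => z; rewrite !inE; case: eqP => // ->.
  by rewrite (negbTE aS) !andbF.
move=> /imsetP[S' S'I ->].
have [SA aS] := notin S' (subsetP (subset_trans (subsetIl _ _) (subsetUl _ _)) _ S'I).
move: S'I; rewrite !inE => /andP[/andP[_ /shattersP sh0] /andP[_ /shattersP sh1]].
rewrite subUset sub1set aA SA; apply/shattersP => B BS.
have BaS : B :\ a \subset S' by rewrite subDset.
case: (boolP (a \in B)) => aB.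
  have [_ /imsetP[f + ->] fB] := sh1 _ BaS; rewrite inE => /andP[fF af].
  exists f => //; rewrite -(setD1K aB) -fB; apply/setP => z; rewrite !inE.
  by case: eqP => // ->; rewrite af.
have [f + fB] := sh0 _ BaS; rewrite inE => /andP[fF af].
exists f => //; rewrite -[RHS](_ : B :\ a = _); last first.
  by apply/setP => z; rewrite !inE; case: eqP => // ->; rewrite (negbTE aB).
rewrite -fB; apply/setP => z; rewrite !inE; case: eqP => // ->.
by rewrite (negbTE af).
Qed.

(** Such a set is read off [v] slots, each holding a point or [None]. This crude count stands in for
    the binomial sum of Sauer-Shelah. *)
Lemma card_small_sets (T : finType) (v : nat) :
  (#|[set S : {set T} | (#|S| <= v)%N]%SET| <= #|T|.+1 ^ v)%N.
Proof.
pose phi (h : {ffun 'I_v -> option T}) : {set T} :=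
  [set x | Some x \in codom h]%SET.
apply: (@leq_trans #|[set phi h | h in [set: {ffun 'I_v -> option T}]%SET]%SET|).
  apply: subset_leq_card; apply/subsetP => S; rewrite inE => Sv.
  apply/imsetP; exists [ffun i : 'I_v => nth None (map Some (enum S)) i]; first by rewrite inE.
  apply/setP => x; rewrite inE; apply/idP/codomP => [xS|[i]].
    have xi : (index x (enum S) < size (enum S))%N by rewrite index_mem mem_enum.
    have iv : (index x (enum S) < v)%N by apply: leq_trans xi _; rewrite -cardE.
    exists (Ordinal iv); rewrite ffunE /= (nth_map x)// nth_index// mem_enum//.
  rewrite ffunE => e.
  have : Some x \in map Some (enum S).
    rewrite e; apply: mem_nth; rewrite ltnNge; apply/negP => le.
    by rewrite nth_default in e.
  by rewrite mem_map ?mem_enum//; exact: Some_inj.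
apply: leq_trans (leq_imset_card _ _) _.
by rewrite cardsT card_ffun card_option card_ord.
Qed.

(** Realizing every [g] forces [s] to be injective, so [k] is the size of a genuine shattered set.
    Families of points, rather than subsets, match [traces] and compose well with resampling. *)
Definition vc_le (v : nat) (I : finType) (F : {set {ffun I -> bool}}) :=
  forall k (s : 'I_k -> I),
    (forall g : 'I_k -> bool, exists2 f, f \in F & forall i, f (s i) = g i) ->
    (k <= v)%N.

Lemma sauer (v : nat) (I : finType) (F : {set {ffun I -> bool}}) :
  vc_le v F -> (#|F| <= #|I|.+1 ^ v)%N.
Proof.
move=> vcF; pose F' := [set [set x | f x]%SET | f : {ffun I -> bool} in F]%SET.
have -> : #|F| = #|F'|.
  rewrite card_in_imset// => f g _ _ /setP e; apply/ffunP => x.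
  by have := e x; rewrite !inE.
have F'T : F' \subset powerset setT by rewrite powersetT subsetT.
apply: leq_trans (pajor F'T) _; apply: leq_trans (card_small_sets I v).
apply: subset_leq_card; apply/subsetP => S; rewrite !inE => /andP[_ /shattersP sh].
apply: (vcF _ (@enum_val _ (mem S))) => g.
have [|_ /imsetP[f fF ->] fB] := sh [set enum_val i | i : 'I_#|S| & g i]%SET.
  by apply/subsetP => _ /imsetP[i _ ->]; exact: enum_valP.
exists f => // i; move/setP/(_ (enum_val i)) : fB; rewrite !inE.
rewrite enum_valP andbT => ->; apply/imsetP/idP => [[j + /enum_val_inj ->]|gi].
  by rewrite inE.
by exists i => //; rewrite inE.
Qed.

(** * Packing and chaining *)

Lemma card_bigcup_leq (I T : finType) (P : pred I) (A : I -> {set T}) :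
  (#|\bigcup_(i | P i) A i| <= \sum_(i | P i) #|A i|)%N.
Proof.
elim/big_rec2: _ => [|i m B _ IH]; first by rewrite cards0.
by rewrite (leq_trans (leq_card_setU _ _))// leq_add2l.
Qed.

Lemma card_bigcup_ler {R : numDomainType} (I T : finType) (P : pred I) (A : I -> {set T}) :
  #|\bigcup_(i | P i) A i|%:R <= \sum_(i | P i) #|A i|%:R :> R.
Proof. by rewrite -natr_sum ler_nat card_bigcup_leq. Qed.

Lemma leq_expn_l (m a b : nat) : (a <= b -> a ^ m <= b ^ m)%N.
Proof. by case: m => // m; rewrite leq_exp2r. Qed.

(** For [L > 1] this is Bernoulli's inequality for [(1 + 1 / (L - 1)) ^ L], cleared of denominators:
    each block of [L] draws halves the chance that two separated functions agree. *)
Lemma bernoulli_half (L : nat) : (0 < L -> 2 * L.-1 ^ L <= L ^ L)%N.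
Proof.
case: L => // k _; case: k => // k /=.
have h m : (k.+1 ^ m * (k.+1 + m) <= k.+1 * k.+2 ^ m)%N.
  elim: m => [|m IH]; first by rewrite !expn0; lia.
  rewrite !expnS; move: IH; set a := (k.+1 ^ m)%N; set b := (k.+2 ^ m)%N; nia.
have := h k.+2; rewrite [(k.+1 ^ k.+2)%N]expnS.
set a := (k.+1 ^ k.+1)%N; set b := (k.+2 ^ k.+2)%N; nia.
Qed.

Definition hamming (I : finType) (f g : {ffun I -> bool}) :=
  #|[set i | f i != g i]%SET|.

Lemma hammingC (I : finType) (f g : {ffun I -> bool}) : hamming f g = hamming g f.
Proof. by congr #|pred_of_set _|; apply/setP => i; rewrite !inE eq_sym. Qed.

Lemma hamming_triangle (I : finType) (g f h : {ffun I -> bool}) :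
  (hamming f h <= hamming f g + hamming g h)%N.
Proof.
apply: leq_trans (leq_card_setU _ _); apply: subset_leq_card.
by apply/subsetP => i; rewrite !inE; case: (f i); case: (g i); case: (h i).
Qed.

Lemma hamming_eq0 (I : finType) (f g : {ffun I -> bool}) :
  hamming f g = 0%N -> f = g.
Proof.
move/eqP; rewrite cards_eq0 => /eqP/setP h; apply/ffunP => i.
by have := h i; rewrite !inE => /negbFE/eqP.
Qed.

(* A random sample of [L * t] points separates [f] from [g] with probability
   at least [1 - (1 - 1 / L) ^ (L * t)], hence at least [1 - 2 ^ - t]. *)
Lemma separating_sample (I : finType) (F : {set {ffun I -> bool}}) (L t : nat) :
  (0 < L)%N -> (0 < #|I|)%N ->
  {in F &, forall f g, f != g -> (#|I| <= L * hamming f g)%N} ->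
  (#|F| ^ 2 < 2 ^ t)%N ->
  exists s : {ffun 'I_(L * t) -> I},
    forall f g : {ffun I -> bool}, f \in F -> g \in F ->
      (forall i, f (s i) = g (s i)) -> f = g.
Proof.
move=> L0 I0 sepF Ft; set m := (L * t)%N.
pose agree (p : {ffun I -> bool} * {ffun I -> bool}) :=
  [set s : {ffun 'I_m -> I} | [forall i, p.1 (s i) == p.2 (s i)]]%SET.
pose Q := [set p | (p.1 \in F) && (p.2 \in F) && (p.1 != p.2)]%SET.
case: (boolP [exists s : {ffun 'I_m -> I}, s \notin \bigcup_(p in Q) agree p]).
  move=> /existsP[s /bigcupP hs]; exists s => f g fF gF fg; apply/eqP.
  apply/negPn/negP => nfg; apply: hs; exists (f, g); first by rewrite inE/= fF gF.
  by rewrite inE; apply/forallP => i; rewrite /= fg.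
rewrite negb_exists => /forallP all; exfalso.
(* If no sample separated [F], the sets [agree p] would cover all samples; but there are fewer than
   [2 ^ t] pairs, and each set holds at most the share [(1 - 1 / L) ^ (L * t) <= 2 ^ - t]. *)
have cover : (#|I| ^ m <= \sum_(p in Q) #|agree p|)%N.
  apply: leq_trans (card_bigcup_leq _ _).
  rewrite -[X in (_ ^ X)%N](card_ord m) -card_ffun -cardsT; apply: subset_leq_card.
  by apply/subsetP => s _; have := all s; rewrite negbK.
have agreeE p : p \in Q -> (L ^ m * #|agree p| <= L.-1 ^ m * #|I| ^ m)%N.
  rewrite inE => /andP[/andP[p1 p2] p12].
  have -> : #|agree p| = (#|[set i | p.1 i == p.2 i]%SET| ^ m)%N.
    rewrite -[X in (_ ^ X)%N](card_ord m) -card_ffun_on; apply: eq_card => s.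
    rewrite inE; apply/forallP/ffun_onP => h i; have := h i; by rewrite inE.
  rewrite -!expnMn; apply: leq_expn_l.
  have -> : #|[set i | p.1 i == p.2 i]%SET| = (#|I| - hamming p.1 p.2)%N.
    rewrite -(cardsC [set i | p.1 i != p.2 i]%SET) addKn; apply: eq_card => i.
    by rewrite !inE negbK.
  have := sepF _ _ p1 p2 p12; move: (hamming _ _) #|I| => h N; nia.
have cQ : (#|Q| <= #|F| ^ 2)%N.
  rewrite expnS expn1 -cardsX; apply: subset_leq_card; apply/subsetP => p.
  by rewrite !inE => /andP[].
have ineq : (L ^ m * #|I| ^ m <= #|F| ^ 2 * (L.-1 ^ m * #|I| ^ m))%N.
  apply: (@leq_trans (L ^ m * \sum_(p in Q) #|agree p|)); first by rewrite leq_mul2l cover orbT.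
  rewrite big_distrr /=; apply: leq_trans (leq_sum _ agreeE) _.
  by rewrite sum_nat_const leq_mul2r cQ orbT.
have half : (2 ^ t * L.-1 ^ m <= L ^ m)%N.
  by rewrite /m !expnM -expnMn; apply: leq_expn_l; apply: bernoulli_half.
have Im : (0 < #|I| ^ m)%N by rewrite expn_gt0 I0.
have Lm : (0 < L ^ m)%N by rewrite expn_gt0 L0.
move: ineq half Ft Im Lm; move: (L ^ m)%N (L.-1 ^ m)%N (#|I| ^ m)%N (#|F| ^ 2)%N (2 ^ t)%N.
move=> a b c f p; rewrite mulnA leq_mul2r => /orP[/eqP ->//|h1] h2 h3 _ a0.
nia.
Qed.

(** With [k = 2 (w + 1)] and [s = t %/ k], one has [t < k * 2 ^ s], whose power [w + 1] uses only
    half of the exponent of [2 ^ (k * s) <= 2 ^ t]; the other half beats the constant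
    [2 * k ^ (w + 1)]. *)
Lemma leq_pow_pow2 (w : nat) :
  exists T, forall t, (T <= t -> t ^ w < 2 ^ t.-1)%N.
Proof.
exists (2 * w.+1 * (2 * w.+1).+1)%N => t tT; pose k := (2 * w.+1)%N.
have tw : (t ^ w <= t ^ w.+1)%N by rewrite expnS leq_pmull//; nia.
apply: (leq_ltn_trans tw); rewrite -(ltn_pmul2l (isT : (0 < 2)%N)) -expnS prednK; last nia.
pose s := (t %/ k)%N.
have sk : (k.+1 <= s)%N by rewrite leq_divRL// mulnC.
have ts : (t < k * s.+1)%N by rewrite mulnC ltn_ceil.
have h1 : (t ^ w.+1 <= (k * 2 ^ s) ^ w.+1)%N.
  by apply: leq_expn_l; apply: (leq_trans (ltnW ts)); rewrite leq_mul2l ltn_expl// orbT.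
have h2 : (2 * k ^ w.+1 < 2 ^ (s * w.+1))%N.
  have : (k ^ w.+1 < (2 ^ k) ^ w.+1)%N by rewrite ltn_exp2r// ltn_expl.
  rewrite -expnM -(ltn_pmul2l (isT : (0 < 2)%N)) -expnS => /leq_trans; apply.
  by rewrite leq_exp2l//; nia.
have h3 : (2 ^ (k * s) <= 2 ^ t)%N by rewrite leq_exp2l// mulnC leq_trunc_div.
apply: leq_trans h3; apply: (@leq_ltn_trans (2 * (k * 2 ^ s) ^ w.+1)).
  by rewrite leq_mul2l h1.
rewrite expnMn mulnA -expnM.
have -> : (k * s = s * w.+1 + s * w.+1)%N by rewrite /k; lia.
by rewrite expnD ltn_pmul2r// expn_gt0.
Qed.

Lemma vc_le_comp (v : nat) (I J : finType) (F : {set {ffun I -> bool}}) (s : J -> I) :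
  vc_le v F -> vc_le v [set [ffun j => f (s j)] | f : {ffun I -> bool} in F]%SET.
Proof.
move=> vcF k u h; apply: (vcF k (s \o u)) => g; have [_ /imsetP[f fF ->] fg] := h g.
by exists f => // i; rewrite -fg ffunE.
Qed.

(* Dudley's packing bound; the weak bound [2 ^ (D * sqrt L)] with [L = 16 ^ j]
   is all that chaining needs. *)
Lemma packing (v : nat) : exists D, forall (j : nat) (I : finType)
    (F : {set {ffun I -> bool}}), vc_le v F -> (0 < #|I|)%N ->
    {in F &, forall f g, f != g -> (#|I| <= 16 ^ j * hamming f g)%N} ->
  (#|F| <= 2 ^ (D * 4 ^ j))%N.
Proof.
have [T hT] := leq_pow_pow2 (3 * (2 * v)).
exists (T + 2)%N => j I F vcF I0 sepF.
pose t := (trunc_log 2 (#|F| ^ 2)).+1.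
have Ft : (#|F| ^ 2 < 2 ^ t)%N by exact: trunc_log_ltn.
have Ft' : (#|F| <= 2 ^ t)%N by apply: leq_trans (ltnW Ft); case: #|F| => // m; rewrite leq_pmull.
apply: (leq_trans Ft'); rewrite leq_exp2l//.
case: (posnP #|F|) => [F0|F0].
  rewrite /t F0 exp0n// trunc_log0.
  by have : (0 < 4 ^ j)%N; [rewrite expn_gt0|move: (4 ^ j)%N => a; nia].
(* Were [t] this large, the sample of [16 ^ j * t] points would have fewer than [t ^ 3] points. It
   keeps the members of [F] distinct, so Sauer's bound gives [2 ^ (t - 1) <= #|F| ^ 2 <= t ^ (6 v)],
   impossible beyond [T]. *)
rewrite leqNgt; apply/negP => tD.
have [s hs] := separating_sample (L := 16 ^ j) (t := t) (expn_gt0 16 j) I0 sepF Ft.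
pose G := [set [ffun i => f (s i)] | f : {ffun I -> bool} in F]%SET.
have GF : #|G| = #|F|.
  rewrite card_in_imset// => f g fF gF /ffunP e; apply: hs => // i.
  by have := e i; rewrite !ffunE.
have := sauer (vc_le_comp (s := s) vcF); rewrite -/G GF card_ord => Fle.
have lo : (2 ^ t.-1 <= #|F| ^ 2)%N by apply: trunc_logP; rewrite // expn_gt0 F0.
have tT : (T + 2 <= t)%N.
  by apply: leq_trans (ltnW tD); rewrite leq_pmulr// expn_gt0.
have Lt : ((16 ^ j * t).+1 <= t ^ 3)%N.
  have e : (16 ^ j = 4 ^ j * 4 ^ j)%N by rewrite -expnMn.
  have : (2 * 4 ^ j <= t)%N.
    by apply: leq_trans (ltnW tD); rewrite leq_mul2r leq_addl orbT.
  have := expn_gt0 4 j; rewrite e !expnS expn0 /=; set a := (4 ^ j)%N => a0 at2.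
  have : (4 * (a * a) <= t * t)%N by nia.
  nia.
have : (2 ^ t.-1 <= t ^ (3 * (2 * v)))%N.
  apply: (leq_trans lo); rewrite expnM mulnC expnM; apply: leq_expn_l.
  by apply: (leq_trans Fle); apply: leq_expn_l.
rewrite leqNgt hT//; lia.
Qed.

(** A maximal separated subset is a net, since a point far from all of it could be added; its size
    is bounded by [packing]. *)
Lemma separated_net (v : nat) : exists D, forall (j : nat) (I : finType)
    (F : {set {ffun I -> bool}}), vc_le v F -> (0 < #|I|)%N ->
  exists G : {set {ffun I -> bool}}, [/\ G \subset F, (#|G| <= 2 ^ (D * 4 ^ j))%N &
    forall f, f \in F -> exists2 g, g \in G & (16 ^ j * hamming f g <= #|I|)%N].
Proof.
have [D hD] := packing v; exists D => j I F vcF I0.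
pose sep (G : {set {ffun I -> bool}}) := (G \subset F) &&
  [forall f in G, forall g in G, (f != g) ==> (#|I| < 16 ^ j * hamming f g)%N].
have [|G /maxsetP[/andP[GF /forall_inP sepG] maxG]] := @ex_maxset _ sep.
  by exists set0; rewrite /sep sub0set; apply/forall_inP => f; rewrite inE.
have sepG' f g : f \in G -> g \in G -> f != g -> (#|I| < 16 ^ j * hamming f g)%N.
  by move=> fG gG fg; have /forall_inP/(_ _ gG)/implyP := sepG _ fG; apply.
exists G; split => //.
  apply: hD => // [k s h|f g fG gG fg]; last by rewrite ltnW// sepG'.
  by apply: (vcF k s) => g; have [f fG fg] := h g; exists f => //; exact: (subsetP GF).
move=> f fF; case: (boolP [exists g in G, (16 ^ j * hamming f g <= #|I|)%N]).
  by move=> /exists_inP[g]; exists g.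
rewrite negb_exists_in => /forall_inP far.
suff fG : f \in G.
  by have := far _ fG; rewrite /hamming eq_card0 ?muln0// => i; rewrite !inE eqxx.
suff <- : f |: G = G by rewrite setU11.
apply: maxG; last exact: subsetUr.
rewrite /sep subUset sub1set fF GF; apply/forall_inP => g /setU1P[->|gG];
  apply/forall_inP => h /setU1P[->|hG]; apply/implyP => // gh.
- by rewrite eqxx in gh.
- by rewrite ltnNge far.
- by rewrite hammingC ltnNge far.
- exact: sepG'.
Qed.

(* Swapping the [k]-th entry of two samples when [s k] flips the sign of the
   [k]-th difference. *)
Definition signed_gap {R : realType} n (s : {ffun 'I_n -> bool})
    (f : {ffun 'I_n * bool -> bool}) : R :=
  \sum_k (-1) ^+ s k * ((f (k, false))%:R - (f (k, true))%:R).

(** The factor [2] is attained when both entries of a pair change in opposite directions: the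
    difference moves by [2], its square by [4], against two disagreements. *)
Lemma gap_variation {R : realType} n (f g : {ffun 'I_n * bool -> bool}) :
  \sum_k ((f (k, false))%:R - (f (k, true))%:R
        - ((g (k, false))%:R - (g (k, true))%:R)) ^+ 2 <=
  2 * (hamming f g)%:R :> R.
Proof.
have -> : (hamming f g)%:R =
    \sum_(k < n) ((f (k, false) != g (k, false))%:R + (f (k, true) != g (k, true))%:R) :> R.
  rewrite /hamming -sum1_card big_mkcond /= natr_sum.
  have -> : \sum_(p : 'I_n * bool) (if p \in [set i | f i != g i]%SET then 1%N else 0%N)%:R =
      \sum_(p : 'I_n * bool) (f p != g p)%:R :> R.
    by apply: eq_bigr => p _; rewrite inE; case: (_ != _).
  rewrite (eq_bigr (fun p => (f (p.1, p.2) != g (p.1, p.2))%:R)); last by case.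
  rewrite -(pair_bigA _ (fun k b => (f (k, b) != g (k, b))%:R)) /=.
  by apply: eq_bigr => k _; rewrite big_bool addrC.
rewrite big_distrr; apply: ler_sum => k _ /=.
by case: (f (k, false)); case: (f (k, true)); case: (g (k, false)); case: (g (k, true)) => /=;
  rewrite !expr2; lra.
Qed.

Lemma signed_gap_tail {R : realType} n (f g : {ffun 'I_n * bool -> bool}) (t W : R) :
  0 < W -> 0 <= t -> 2 * (hamming f g)%:R <= W ->
  #|[set s | t <= signed_gap s f - signed_gap s g]%SET|%:R <=
  2 ^+ n * expR (- (t ^+ 2 / (8 * W))).
Proof.
move=> W0 t0 hW; have := rademacher_tail W0 (le_trans (gap_variation f g) hW) t0.
rewrite card_ord; congr (_%:R <= _); apply: eq_card => s; rewrite !inE.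
by rewrite /signed_gap -sumrB; congr (_ <= _); apply: eq_bigr => k _; rewrite mulrBr.
Qed.

Lemma pow2_le_expR {R : realType} k : 2 ^+ k <= expR k%:R :> R.
Proof.
rewrite -[k%:R]mulr1 expRM_natl lerXn2r ?nnegrE ?expR_ge0//.
by have := expR_ge1Dx (1 : R).
Qed.

Lemma sum_halves {R : realType} J : \sum_(j < J) (2 ^- j.+1 : R) <= 1.
Proof.
suff -> : \sum_(j < J) (2 ^- j.+1 : R) = 1 - 2 ^- J.
  by rewrite lerBlDr lerDl invr_ge0 exprn_ge0.
elim: J => [|J IH]; first by rewrite big_ord0 expr0 invr1 subrr.
by rewrite big_ord_recr /= IH exprS invfM; lra.
Qed.

(** By contraposition: join [f0] to [f] through net points ever closer to [f]. If every link gained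
    less than its share [2 ^ - (j + 1)], the telescoped gain would stay below the total. *)
Lemma chain_union {R : realType} n (f0 : {ffun 'I_n * bool -> bool})
    (F : {set {ffun 'I_n * bool -> bool}})
    (G : nat -> {set {ffun 'I_n * bool -> bool}}) (eps : R) :
  (0 < n)%N -> 0 < eps -> G 0%N = [set f0]%SET ->
  (forall j, G j \subset F) ->
  (forall j f, f \in F -> exists2 g, g \in G j & (16 ^ j * hamming f g <= n.*2)%N) ->
  [set s : {ffun 'I_n -> bool} |
     [exists f in F, n%:R * eps <= signed_gap s f - signed_gap s f0]]%SET \subset
  \bigcup_(j < n.*2) \bigcup_(p in [set p | (p.1 \in G j.+1) && (p.2 \in G j) &&
                                   (16 ^ j.+1 * hamming p.1 p.2 <= 17 * n.*2)%N]%SET)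
    [set s | n%:R * eps * 2 ^- j.+1 <= signed_gap s p.1 - signed_gap s p.2]%SET.
Proof.
move=> n0 e0 G0 GF net; apply/subsetP => s; rewrite inE => /exists_inP[f fF far].
apply/negPn/negP => hs.
have step (j : nat) g g' : (j < n.*2)%N -> g \in G j.+1 -> g' \in G j ->
    (16 ^ j.+1 * hamming g g' <= 17 * n.*2)%N ->
    signed_gap s g - signed_gap s g' < n%:R * eps * 2 ^- j.+1.
  move=> jn gG g'G gg'; rewrite ltNge; apply/negP => le; case/negP: hs.
  apply/bigcupP; exists (Ordinal jn) => //; apply/bigcupP; exists (g, g').
    by rewrite inE /= gG g'G.
  by rewrite inE.
have ne0 : 0 < n%:R * eps by rewrite mulr_gt0// ltr0n.
have main (j : nat) g : (j <= n.*2)%N -> g \in G j -> (16 ^ j * hamming f g <= n.*2)%N ->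
    signed_gap s g - signed_gap s f0 <= n%:R * eps * (1 - 2 ^- j).
  elim: j g => [|j IH] g jn gG fg.
    by move: gG; rewrite G0 inE => /eqP ->; rewrite !subrr expr0 invr1 subrr mulr0.
  have [g' g'G fg'] := net j _ fF.
  have h2 := IH g' (ltnW jn) g'G fg'.
  (* Both ends are near [f], at the scales [16 ^ - (j + 1)] and [16 ^ - j]; the triangle inequality
     gives [1 + 16 = 17] units of the finer scale. *)
  have h1 : signed_gap s g - signed_gap s g' < n%:R * eps * 2 ^- j.+1.
    apply: step => //; have := hamming_triangle f g g'; rewrite (hammingC g f).
    move: fg fg'; rewrite expnS; move: (16 ^ j)%N (hamming _ _) (hamming _ _) (hamming _ _).
    by move=> a b c d; nia.
  have -> : 1 - 2 ^- j.+1 = (1 - 2 ^- j) + 2 ^- j.+1 :> R.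
    by rewrite exprS invfM; lra.
  by rewrite mulrDr; lra.
(* The chain stops here: [16 ^ (2 n) > 2 n], so the distance from [f] to the net is [0] and [f]
   itself is a net point. *)
have [g gG fg] := net n.*2 _ fF.
have fgE : f = g.
  apply: hamming_eq0; move: fg; have := ltn_expl n.*2 (isT : (1 < 16)%N).
  by case: (hamming f g) => // h; move: (16 ^ _)%N => a; nia.
have := main n.*2 g (leqnn _) gG fg; rewrite -fgE => /(le_trans far).
rewrite leNgt => /negP; apply; rewrite gtr_pMr// ltrBlDr ltrDl invr_gt0.
by rewrite exprn_gt0.
Qed.

(* Nets at Hamming scale [16 ^- j] give increments of variance [O(n * 16 ^- j)];
   allotting the share [2 ^- j] of the deviation to level [j], level [j] fails
   with probability [exp (- c n eps^2 4 ^ j)], which beats the net sizes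
   [exp (O(4 ^ j))] without any logarithmic loss. *)
Lemma chaining {R : realType} (v : nat) : exists B : R, forall n
    (F : {set {ffun 'I_n * bool -> bool}}) f0 (eps : R),
  vc_le v F -> f0 \in F -> (0 < n)%N -> 0 < eps -> B <= n%:R * eps ^+ 2 ->
  #|[set s : {ffun 'I_n -> bool} |
     [exists f in F, n%:R * eps <= signed_gap s f - signed_gap s f0]]%SET|%:R <=
  2 ^+ n * expR (- (n%:R * eps ^+ 2 / 1088)).
Proof.
(* This threshold is what makes [a >= 2 D + 1] below, so that the exponent dominates the net
   sizes. *)
have [D hD] := separated_net v; exists (1088 * (2 * D%:R + 1)) => n F f0 eps.
move=> vcF f0F n0 e0 hB.
have I0 : (0 < #|{: 'I_n * bool}|)%N by rewrite card_prod card_ord card_bool; lia.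
have [G0 hG0] := boolp.choice (fun j => hD j _ F vcF I0).
(* At scale [16 ^ 0] every function is within [2 n] of [f0], so the coarsest net may be taken to be
   [f0] alone. *)
pose G j := if j is 0 then [set f0]%SET else G0 j.
have GF j : G j \subset F by case: j => [|j]; [rewrite sub1set|have [] := hG0 j.+1].
have cG j : (#|G j| <= 2 ^ (D * 4 ^ j))%N.
  by case: j => [|j]; [rewrite cards1 expn_gt0|have [] := hG0 j.+1].
have cI : #|{: 'I_n * bool}| = n.*2 by rewrite card_prod card_ord card_bool muln2.
have net j f : f \in F -> exists2 g, g \in G j & (16 ^ j * hamming f g <= n.*2)%N.
  case: j => [|j] fF; last by have [_ _] := hG0 j.+1; rewrite cI; apply.
  by exists f0; [rewrite inE|rewrite mul1n -cI max_card].
have sub := subset_leq_card (chain_union n0 e0 (erefl : G 0%N = _) GF net).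
move: sub; rewrite -(ler_nat R) => /le_trans; apply.
apply: le_trans (card_bigcup_ler _ _) _.
set a := n%:R * eps ^+ 2 / 1088.
have n0R : 0 < n%:R :> R by rewrite ltr0n.
apply: (@le_trans _ _ (\sum_(j < n.*2) 2 ^+ n * (expR (- a) * 2 ^- j.+1))); last first.
  by rewrite -!big_distrr /= ler_wpM2l ?exprn_ge0// ler_piMr ?expR_ge0// sum_halves.
apply: ler_sum => [[j jn]] _ /=.
apply: le_trans (card_bigcup_ler _ _) _.
set Q := [set _ | _]%SET.
pose w : R := 4 ^+ j.+1.
have w0 : 0 < w by rewrite exprn_gt0.
have tail p : p \in Q -> #|[set s | n%:R * eps * 2 ^- j.+1 <=
    signed_gap s p.1 - signed_gap s p.2]%SET|%:R <= 2 ^+ n * expR (- (2 * a * w)).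
  rewrite inE => /andP[_ hp].
  (* With [w ^ 2 = 16 ^ (j + 1)], a link has length at most [34 n / w ^ 2], and [gap_variation]
     doubles it. As the squared share is [1 / w], the exponent becomes [n eps^2 w / 544 = 2 a w]. *)
  apply: le_trans (signed_gap_tail (W := 68 * n%:R / w ^+ 2) _ _ _) _.
  - by rewrite divr_gt0 ?mulr_gt0 ?exprn_gt0.
  - by rewrite !mulr_ge0 ?invr_ge0 ?exprn_ge0// ltW.
  - rewrite ler_pdivlMr ?exprn_gt0//.
    move: hp; rewrite -(ler_nat R) !natrM natrX -mul2n natrM.
    have -> : 16 ^+ j.+1 = w ^+ 2 :> R.
      by rewrite /w -exprM mulnC exprM; congr (_ ^+ _); rewrite expr2 -natrM.
    by move: (_ ^+ 2) => z; lra.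
  rewrite ler_wpM2l ?exprn_ge0// ler_expR lerN2 le_eqVlt; apply/orP; left; apply/eqP.
  have wE : w = (2 ^+ j.+1) ^+ 2.
    by rewrite /w -exprM mulnC exprM; congr (_ ^+ _); rewrite expr2 -natrM.
  have z0 : 2 ^+ j.+1 != 0 :> R by rewrite gt_eqF ?exprn_gt0.
  by rewrite /a wE; move: z0; set z := 2 ^+ _ => z0; field; rewrite z0 gt_eqF.
apply: le_trans (ler_sum _ tail) _.
rewrite sumr_const -[leLHS]mulr_natl.
have cQ : #|Q|%:R <= expR (2 * D%:R * w).
  apply: (@le_trans _ _ (2 ^ (2 * (D * 4 ^ j.+1)))%:R).
    rewrite ler_nat mul2n -addnn expnD.
    apply: (@leq_trans (#|G j.+1| * #|G j|)).
      rewrite -cardsX; apply: subset_leq_card; apply/subsetP => p.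
      by rewrite !inE => /andP[].
    apply: leq_mul => //; apply: leq_trans (cG j) _.
    by rewrite leq_exp2l// leq_mul2l leq_exp2l// leqnSn orbT.
  by rewrite natrX; apply: le_trans (pow2_le_expR _) _; rewrite ler_expR !natrM natrX mulrA.
rewrite [leLHS]mulrCA ler_wpM2l ?exprn_ge0//.
apply: le_trans (ler_wpM2r (expR_ge0 _) cQ) _.
have aD : 2 * D%:R + 1 <= a by rewrite /a ler_pdivlMr// mulrC.
have jw : 1 + j.+1%:R <= w.
  rewrite /w -natrX nat1r ler_nat.
  by elim: (j.+1) => // k; rewrite expnS; clear; lia.
have D0 : 0 <= D%:R :> R by [].
have ej : expR (- j.+1%:R) <= 2 ^- j.+1 :> R.
  by rewrite expRN lef_pV2 ?posrE ?expR_gt0 ?exprn_gt0// pow2_le_expR.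
apply: le_trans (ler_wpM2l (expR_ge0 _) ej).
rewrite -!expRD ler_expR.
(* Of the exponent [2 a w], one copy of [a w] absorbs the count [2 D w] and leaves [w >= j + 1],
   which pays for [2 ^ - (j + 1)]; the other copy leaves [a]. *)
have h1 : (2 * D%:R + 1) * w <= a * w by rewrite ler_wpM2r// ltW.
have j0 : 0 <= j.+1%:R :> R by [].
have h2 : a <= a * w by rewrite ler_peMr//; [move: aD D0|move: jw j0]; clear; lra.
by move: jw j0 h1 h2; move: (j.+1%:R : R) => J; clear; lra.
Qed.

(** * Compactness of closed convergence and measurability *)

From mathcomp Require Import all_classical all_reals all_analysis measurable_realfun.
Import numFieldNormedType.Exports.
Local Open Scope classical_set_scope.
Local Open Scope ring_scope.

Definition is_base (T : topologicalType) (W : nat -> set T) :=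
  (forall i, open (W i)) /\
  forall z A, nbhs z A -> exists i, W i z /\ W i `<=` A.

Lemma base_of_separable_metrizable {R : realType} (X : topologicalType) :
  separable X -> completely_metrizable R X -> exists U : nat -> set X, is_base U.
Proof.
move=> [D cD dD] [d [[d0 deq dC dtri] dnbhs _]].
have dxx a : d a a = 0 by apply/(deq a a).
have openball a e : open [set y | d a y < e].
  rewrite openE => y /= ye; apply/dnbhs; exists (e - d a y); first by rewrite subr_gt0.
  by move=> z yz /=; have := dtri a y z I I I; lra.
have /countable_injP[g gD] := cD.
(* Countability only gives an injection [g] into [nat], so the union selects the unique centre
   numbered [n], or is empty if there is none. *)
exists (fun i => if unpickle i is Some (n, m) then
   \bigcup_(a in [set a | D a /\ g a = n]) [set y | d a y < m.+1%:R^-1] else set0).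
split=> [i|x A /dnbhs[e e0 eA]].
  by case: (unpickle i) => [[n m]|]; [apply: bigcup_open => a _|exact: open0].
have [m me] : exists m : nat, (m.+1%:R^-1 : R) < e / 2.
  have e20 : 0 < e / 2 by rewrite divr_gt0.
  exists (Num.truncn (e / 2)^-1); rewrite invf_plt ?posrE//.
  by rewrite truncnS_gt.
have m0 : 0 < (m.+1%:R^-1 : R) by rewrite invr_gt0.
have [a [ax Da]] : [set y | d x y < m.+1%:R^-1] `&` D !=set0.
  by apply: dD; [exists x; rewrite /= dxx|exact: openball].
exists (pickle (g a, m)); rewrite pickleK; split.
  by exists a => //=; rewrite dC.
move=> y [b [Db gb]] /= by_; apply: eA.
have ba : b = a by apply: gD; rewrite ?inE.
rewrite ba in by_; have := dtri x a y I I I; rewrite /= in ax *.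
move=> h; apply: (le_lt_trans h); rewrite (splitr e) ltrD//.
  exact: lt_trans ax me.
exact: lt_trans by_ me.
Qed.

Lemma base_prod (X : ptopologicalType) (U : nat -> set X) : is_base U ->
  exists W : nat -> set (X * X), is_base W /\
    forall i, measurable (W i : set (borel X * borel X)).
Proof.
move=> [oU bU].
exists (fun i => if unpickle i is Some (a, b) then U a `*` U b else set0); split; [split|].
- move=> i; case: (unpickle i) => [[a b]|]; last exact: open0.
  rewrite openE => -[x y] [/= ax by_]; exists (U a, U b) => //.
  by split; apply: open_nbhs_nbhs; split => //; exact: oU.
- move=> [x y] A [[A1 A2] /= [/bU[a [ax aA]] /bU[b [by_ bA]]] A12].
  exists (pickle (a, b)); rewrite pickleK; split=> // -[x' y'] [/= h1 h2].
  by apply: A12; split; [exact: aA|exact: bA].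
- move=> i; case: (unpickle i) => [[a b]|]; last exact: measurable0.
  by apply: measurableX; apply: sub_sigma_algebra; exact: oU.
Qed.

Lemma open_measurable_base (T : topologicalType) d (M : measurableType d) (W : nat -> set T)
    (h : M -> T) :
  is_base W -> (forall i, measurable (h @^-1` W i)) ->
  forall A, open A -> measurable (h @^-1` A).
Proof.
move=> [oW bW] mW A oA.
have -> : A = \bigcup_(i in [set i | W i `<=` A]) W i.
  apply/seteqP; split=> [z Az|z [i iA] /iA//].
  by have [i [iz iA]] := bW z A (open_nbhs_nbhs (conj oA Az)); exists i.
by rewrite preimage_bigcup; apply: bigcup_measurable => i _; exact: mW.
Qed.

(** Cantor's diagonal argument: the infinite sets [S i] decrease, passing from [S i] to [S i.+1]
    settles property [i], and [k m] is taken in [S m]; hence the threshold [i.+1]. *)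
Lemma diagonal_subsequence (f : nat -> nat -> Prop) :
  exists k : nat -> nat, increasing_seq k /\
    forall i, exists N, (forall m, (N <= m)%N -> f (k m) i) \/
                        (forall m, (N <= m)%N -> ~ f (k m) i).
Proof.
pose inf (S : set nat) := forall N, exists2 n, (N <= n)%N & S n.
pose next (S : set nat) i := if `[< inf (S `&` [set n | f n i]) >]
  then S `&` [set n | f n i] else S `&` [set n | ~ f n i].
pose fix S i := if i is j.+1 then next (S j) j else setT.
have infS i : inf (S i).
  elim: i => [N|i IH]; first by exists N.
  rewrite /= /next; case: asboolP => // /existsNP[N hN] M.
  have [n Mn Sn] := IH (maxn M N); exists n; first by rewrite (leq_trans _ Mn)// leq_maxl.
  split=> // fn; apply: hN; exists n => //; by rewrite (leq_trans _ Mn)// leq_maxr.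
have Sdec i j : (i <= j)%N -> S j `<=` S i.
  move=> /subnKC <-; elim: (j - i)%N => [|m IH]; first by rewrite addn0.
  rewrite addnS => n /=; rewrite /next; case: asboolP => _ [/IH//].
have [g hg] : exists g : nat -> nat -> nat, forall i N, (N <= g i N)%N /\ S i (g i N).
  have h i N : exists n, (N <= n)%N /\ S i n by have [n h1 h2] := infS i N; exists n.
  have [g hg] := choice (fun p : nat * nat => h p.1 p.2).
  by exists (fun i N => g (i, N)) => i N; exact: (hg (i, N)).
pose fix k m := if m is l.+1 then g m (k l).+1 else g 0%N 0%N.
have kS m : S m (k m) by case: m => [|m] /=; [|have [] := hg m.+1 (k m).+1].
exists k; split.
  by apply/increasing_seqP => m; rewrite /= ltEnat /=; have [] := hg m.+1 (k m).+1.
move=> i; exists i.+1.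
have : forall m, (i.+1 <= m)%N -> next (S i) i (k m) by move=> m im; exact: (Sdec _ _ im).
rewrite /next; case: asboolP => _ h; [left|right] => m /h[].
by [].
by [].
Qed.

Lemma leq_increasing_seq (k : nat -> nat) m : increasing_seq k -> (m <= k m)%N.
Proof.
move=> /increasing_seqP kS; elim: m => // m IH.
by apply: leq_ltn_trans IH _; have := kS m; rewrite ltEnat.
Qed.

Lemma basic_nbhs (T : topologicalType) (W : nat -> set T) (z : T) m : is_base W ->
  nbhs z [set p | forall i, (i < m)%N -> W i z -> W i p].
Proof.
move=> [oW _]; elim: m => [|m IH]; first by apply: filterS filterT => p _ i.
have [Wm|nWm] := pselect (W m z); last first.
  by apply: filterS IH => p Vp i; rewrite ltnS leq_eqVlt => /orP[/eqP -> //|]; exact: Vp.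
have := open_nbhs_nbhs (conj (oW m) Wm); apply: filterS2 IH => p Vp Wp i.
by rewrite ltnS leq_eqVlt => /orP[/eqP -> //|]; exact: Vp.
Qed.

(** Along a diagonal subsequence each basic open set is eventually hit or eventually missed. The
    limit consists of the points whose basic neighbourhoods are all eventually hit; a cluster point
    of the subsequence has no eventually missed neighbourhood. Nonemptiness is used because
    convergence asks for a point of every term. *)
Lemma closed_convergence_compact (X : topologicalType) (W u : nat -> set (X * X)) :
  is_base W -> (forall n, u n !=set0) ->
  exists (k : nat -> nat) (P : set (X * X)), increasing_seq k /\ closed_convergence (u \o k) P.
Proof.
move=> bW u0.
have [k [kinc hk]] := diagonal_subsequence (fun n i => u n `&` W i !=set0).
exists k, [set z | forall i, W i z -> exists N, forall m, (N <= m)%N -> u (k m) `&` W i !=set0].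
split=> //; split=> [z Pz|l linc w z uw wz i Wiz].
  pose V j := [set p | forall i, (i < j)%N -> W i z -> W i p].
  (* Pick a point in the finest [V j], [j <= m], that [u (k m)] meets; the [V j] decrease, so it
     lies in all those that are met. *)
  have /choice[w hw] m : exists p,
      u (k m) p /\ forall j, (j <= m)%N -> u (k m) `&` V j !=set0 -> V j p.
    elim: {2}m => [|j [p [up hp]]].
      have [p up] := u0 (k m); exists p; split=> // j; rewrite leqn0 => /eqP -> _ i //.
    case: (pselect (u (k m) `&` V j.+1 !=set0)) => [[p' [up' Vp']]|nV].
      by exists p'; split=> // i ij _ i' i'i; apply: Vp'; exact: leq_trans i'i ij.
    exists p; split=> // i; rewrite leq_eqVlt => /orP[/eqP -> //|]; exact: hp.
  exists w; split; last by move=> m; have [] := hw m.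
  move=> A /(bW.2 z)[i [iz iA]].
  have [i' [i'z i'V]] := bW.2 _ _ (basic_nbhs z i.+1 bW).
  have [N hN] := Pz i' i'z.
  exists (maxn N i.+1) => // m /=; rewrite geq_max => /andP[Nm im].
  apply: iA; have [_ /(_ i.+1 im)] := hw m; apply => //.
  by have [p [up Wp]] := hN m Nm; exists p; split=> //; exact: i'V.
have [N [hN|hN]] := hk i; first by exists N.
have [M _ hM] := wz _ (open_nbhs_nbhs (conj (bW.1 i) Wiz)).
pose m := maxn M N.
have ml := leq_increasing_seq m linc.
have := hN (l m); case; first by rewrite (leq_trans _ ml)// leq_maxr.
by exists (w m); split; [exact: uw|apply: hM; rewrite /= leq_maxl].
Qed.

(** Rectangles with measurable sides: they generate the product sigma-algebra on [J]-tuples and are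
    stable under intersection, so they determine finite measures. *)
Definition boxes d (T : measurableType d) (J : finType) : set (set (J -> T)) :=
  [set A | exists D : J -> set T,
     (forall j, measurable (D j)) /\ A = [set t | forall j, D j (t j)]].

Notation box_type T J := (g_sigma_algebraType (@boxes _ T J)).

Lemma countable_union_ffun d (T : measurableType d) (J : finType)
    (Q : set {ffun J -> nat}) (A : {ffun J -> nat} -> set T) :
  (forall b, Q b -> measurable (A b)) -> measurable (\bigcup_(b in Q) A b).
Proof.
move=> mA; rewrite bigcup_mkcond; apply: countable_bigcupT_measurable => [|b].
  by apply/countable_injP; exists pickle => b b' _ _; exact: (pcan_inj pickleK).
by case: ifPn => [/set_mem/mA//|_]; exact: measurable0.
Qed.

Section Patterns.
Variables (X : ptopologicalType) (W : nat -> set (X * X)).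
Hypothesis bW : is_base W.
Hypothesis mW : forall i, measurable (W i : set (borel X * borel X)).
Variables (J : finType) (C : set (set (X * X))).
Hypothesis C0 : forall P, C P -> P !=set0.

Let TT := (borel X * borel X)%type.

Lemma measurable_box (D : J -> set TT) : (forall j, measurable (D j)) ->
  measurable ([set t | forall j, D j (t j)] : set (box_type TT J)).
Proof. by move=> mD; apply: sub_sigma_algebra; exists D. Qed.

(* By compactness, if every basic box around [t] is hit by a relation of the
   class then so is [t]; hence the complement is a union of basic boxes. *)
Lemma measurable_hits (CC : set (set (X * X))) (a : pred J) :
  closed_in_closed_convergence CC -> (forall P, CC P -> P !=set0) ->
  measurable ([set t | exists P, CC P /\ forall j, a j -> P (t j)] : set (box_type TT J)).
Proof.
move=> clC CC0; rewrite -[X in measurable X]setCK; apply: measurableC.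
pose Q : set {ffun J -> nat} :=
  [set b | ~ exists P, CC P /\ forall j, a j -> P `&` W (b j) !=set0].
suff -> : ~` [set t : J -> X * X | exists P, CC P /\ forall j, a j -> P (t j)] =
    \bigcup_(b in Q) [set t | forall j, W (b j) (t j)].
  apply: countable_union_ffun => b _.
  by apply: (@measurable_box (fun j => W (b j))) => j; exact: mW.
apply/seteqP; split=> [t nt|t [b Qb Wt] [P [CP Pt]]]; last first.
  by apply: Qb; exists P; split=> // j aj; exists (t j); split; [exact: Pt|exact: Wt].
apply: contrapT => nb; apply: nt.
pose V m j := [set p | forall i, (i < m)%N -> W i (t j) -> W i p].
have [b hb] : exists b : nat -> J -> nat, forall m j, W (b m j) (t j) /\ W (b m j) `<=` V m j.
  have h m j := bW.2 _ _ (basic_nbhs (t j) m bW).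
  have [b hb] := choice (fun p : nat * J => h p.1 p.2).
  by exists (fun m j => b (m, j)) => m j; exact: (hb (m, j)).
(* As the [m]-th boxes around the coordinates of [t] shrink, a limit of the relations [u m] hitting
   them passes through the coordinates selected by [a]. *)
have /choice[u hu] m : exists P, CC P /\ forall j, a j -> P `&` W (b m j) !=set0.
  apply: contrapT => nP; apply: nb; exists [ffun j => b m j].
    move=> [P [CP hP]]; apply: nP; exists P; split=> // j /hP; by rewrite ffunE.
  by move=> j /=; rewrite ffunE; have [] := hb m j.
have [k [P [kinc kP]]] := closed_convergence_compact bW (fun n => CC0 _ (hu n).1).
have CP : CC P by apply: clC kP => n; have [] := hu (k n).
exists P; split=> // j aj.
have /choice[w hw] m : exists p, u (k m) p /\ W (b (k m) j) p.
  by have [_ /(_ j aj)[p [up Wp]]] := hu (k m); exists p.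
have [_ /(_ id)] := kP; apply; first by [].
  by move=> m; exact: (hw m).1.
move=> A /(bW.2 (t j))[i [iz iA]]; exists i.+1 => // m /= im; apply: iA.
have [_ /(_ (w m) (hw m).2 i)] := hb (k m) j; apply => //.
exact: leq_trans im (leq_increasing_seq m kinc).
Qed.

(* An excluded point has a basic neighbourhood missing [P], and the relations
   missing given basic open sets form again a closed class. *)
Lemma measurable_pattern (f : J -> bool) :
  closed_in_closed_convergence C -> (forall P, C P -> closed P) ->
  measurable ([set t | exists P, C P /\ forall j, f j = `[< P (t j) >]] :
    set (box_type TT J)).
Proof.
move=> clC closedC.
pose CC (b : {ffun J -> nat}) := [set P | C P /\ forall j, ~~ f j -> P `&` W (b j) = set0].
suff -> : [set t : J -> X * X | exists P, C P /\ forall j, f j = `[< P (t j) >]] =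
    \bigcup_(b in [set: {ffun J -> nat}])
      ([set t | forall j, (if f j then setT else W (b j)) (t j)] `&`
       [set t | exists P, CC b P /\ forall j, f j -> P (t j)]).
  apply: countable_union_ffun => b _; apply: measurableI.
    apply: (@measurable_box (fun j => if f j then setT else W (b j))) => j.
    by case: ifP => _; [exact: measurableT|exact: mW].
  apply: measurable_hits => [u P uC uP|P [/C0//]].
  split; first by apply: clC uP => n; have [] := uC n.
  (* Missing an open set survives the limit: a limit point inside [W (b j)] would be approached by
     points of the [u n], which would enter it. *)
  move=> j nf; apply/seteqP; split=> // z [Pz Wz].
  have [/(_ _ Pz)[w [wz uw]] _] := uP.
  have [N _ hN] := wz _ (open_nbhs_nbhs (conj (bW.1 (b j)) Wz)).
  have [_ /(_ j nf)/seteqP[h _]] := uC N; apply: (h (w N)); split; first exact: uw.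
  by apply: hN => /=.
apply/seteqP; split=> [t [P [CP fP]]|t [b _ [Wt [P [[CP PW] Pt]]]]].
  have /choice[b hb] j : exists i, ~~ f j -> W i (t j) /\ W i `<=` ~` P.
    case: (boolP (f j)) => fj; first by exists 0%N.
    have nP : ~ P (t j) by move/asboolP; rewrite -fP (negbTE fj).
    have := bW.2 (t j) (~` P); case.
      by apply: open_nbhs_nbhs; split=> //; apply: closed_openC; exact: closedC.
    by move=> i hi; exists i.
  exists [ffun j => b j] => //; split.
    by move=> j; case: ifPn => // /hb[h _]; rewrite ffunE.
  exists P; split.
    split=> // j /hb[_ h]; rewrite ffunE; apply/seteqP; split=> // z [Pz /h]; exact.
  by move=> j; rewrite fP => /asboolP.
exists P; split=> // j; apply/idP/asboolP => [|Ptj]; first exact: Pt.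
apply/negPn/negP => nf; have := PW j nf => /seteqP[h _]; apply: (h (t j)); split=> //.
by have := Wt j; rewrite (negbTE nf).
Qed.

End Patterns.

(** * Symmetrization *)

Lemma measurable_to_boxes d d' (T : measurableType d) (M : measurableType d') (J : finType)
    (h : J -> M -> T) :
  (forall j, measurable_fun setT (h j)) ->
  @measurable_fun _ _ M (box_type T J) setT (fun w j => h j w).
Proof.
move=> mh; apply: (@measurability _ _ M (box_type T J) _ _ (@boxes _ T J)) => //.
move=> _ [_ [D [mD ->]] <-].
rewrite setTI.
suff -> : (fun w j => h j w) @^-1` [set t | forall j, D j (t j)] =
    \bigcap_(j in [set: J]) (h j @^-1` D j).
  apply: fin_bigcap_measurable => [|j _]; first exact: finite_finset.
  by rewrite -[X in measurable X]setTI; exact: mh.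
by apply/seteqP; split=> w /= hw j; [move=> _; exact: hw|exact: (hw j)].
Qed.

Lemma boxes_measure_unique d (T : measurableType d) (J : finType) {R : realType}
    (m1 m2 : {measure set (box_type T J) -> \bar R}) :
  (m1 setT < +oo)%E ->
  (forall D : J -> set T, (forall j, measurable (D j)) ->
    m1 [set t | forall j, D j (t j)] = m2 [set t | forall j, D j (t j)]) ->
  forall A, measurable A -> m1 A = m2 A.
Proof.
move=> m1T m12 A mA.
apply: (@measure_unique _ _ (box_type T J) (@boxes _ T J) (fun=> setT)) => //.
- move=> _ _ [D [mD ->]] [E [mE ->]]; exists (fun j => D j `&` E j); split.
    by move=> j; exact: measurableI.
  by apply/seteqP; split=> t /= => [[h1 h2] j|h]; [|split=> j; have [] := h j].
- by move=> _; exists (fun=> setT); split=> //; apply/seteqP; split.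
- by apply/seteqP; split=> // t _; exists 0%N.
- by move=> _ [D [mD ->]]; exact: m12.
Qed.

Section FiniteSums.
Context d (M : measurableType d) {R : realType} (Q : probability M R) (S : finType).
Implicit Type E : S -> set M.

Lemma sum_measure_integral E : (forall s, measurable (E s)) ->
  (\sum_s Q (E s) = \int[Q]_x (\sum_s \1_(E s) x)%:E)%E.
Proof.
move=> mE; under eq_integral do rewrite -sumEFin.
rewrite ge0_integral_sum//.
- by apply: eq_bigr => s _; rewrite integral_indic// setIT.
- by move=> s; apply/measurable_EFinP; exact: measurable_indic.
Qed.

Lemma measurable_sum_indic E : (forall s, measurable (E s)) ->
  measurable_fun setT (fun x => (\sum_s \1_(E s) x : R)%:E).
Proof.
move=> mE; apply/measurable_EFinP; apply: measurable_sum => s.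
exact: measurable_indic.
Qed.

(** With [s] ranging over the swaps, this turns a bound on the number of bad swaps of each fixed
    sample into a bound on probabilities. *)
Lemma sum_measure_le (c : R) E : (forall s, measurable (E s)) ->
  (forall x, \sum_s \1_(E s) x <= c) -> (\sum_s Q (E s) <= c%:E)%E.
Proof.
move=> mE hc; rewrite sum_measure_integral//.
apply: (@le_trans _ _ (\int[Q]_x (cst c%:E) x)%E).
  apply: ge0_le_integral => //.
  - by move=> x _; rewrite lee_fin sumr_ge0.
  - exact: measurable_sum_indic.
  - by move=> x _; rewrite lee_fin.
rewrite integral_cst// [X in (_ * X)%E](_ : _ = 1%E) ?mule1//; exact: probability_setT.
Qed.

Lemma measure_le_sum (A : set M) E : measurable A -> (forall s, measurable (E s)) ->
  (forall x, A x -> exists s, E s x) -> (Q A <= \sum_s Q (E s))%E.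
Proof.
move=> mA mE AE; rewrite sum_measure_integral// -[A]setIT -integral_indic//.
apply: ge0_le_integral => //.
- by apply/measurable_EFinP; exact: measurable_indic.
- exact: measurable_sum_indic.
move=> x _; rewrite lee_fin indicE; case: (boolP (x \in A)) => [/set_mem/AE[s Es]|_].
  by rewrite (bigD1 s)//= indicE mem_set// lerDl sumr_ge0.
by rewrite sumr_ge0.
Qed.

Lemma measure_partition (A : set M) (h : M -> S) : measurable A ->
  (forall s, measurable (A `&` [set x | h x = s])) ->
  (Q A = \sum_s Q (A `&` [set x | h x = s]))%E.
Proof.
move=> mA mE; rewrite sum_measure_integral// -[A in LHS]setIT -integral_indic//.
apply: eq_integral => x _; congr (_%:E).
rewrite (bigD1 (h x))//= big1 ?addr0; last first.
  move=> s /eqP sh; rewrite indicE memNset// => -[_ /= e]; exact: sh.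
by rewrite !indicE in_setI [X in _ && X]mem_set// andbT.
Qed.

End FiniteSums.

Definition trace (T : Type) (J : finType) (P : set T) (t : J -> T) : {ffun J -> bool} :=
  [ffun j => `[< P (t j) >]].

Definition pattern_measurable d (T : measurableType d) (C : set (set T)) :=
  forall (J : finType) (f : J -> bool),
    measurable ([set t | exists P, C P /\ forall j, f j = `[< P (t j) >]] : set (box_type T J)).

Section PatternEvents.
Context d (T : measurableType d).

Lemma pattern_measurable1 (P : set T) : measurable P -> pattern_measurable [set P].
Proof.
move=> mP J f.
suff -> : [set t : J -> T | exists P', [set P] P' /\ forall j, f j = `[< P' (t j) >]] =
    [set t | forall j, (if f j then P else ~` P) (t j)].
  apply: sub_sigma_algebra; exists (fun j => if f j then P else ~` P); split=> // j.
  by case: ifP => _ //; exact: measurableC.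
apply/seteqP; split=> t.
  by move=> [_ [-> h]] j; rewrite h; case: asboolP.
move=> /= h; exists P; split=> // j; have := h j.
by case: (f j) => Pt; apply/esym; [exact/asboolP|exact/asboolPn].
Qed.

(** Traces on [J] take finitely many values, so the uncountable union over [C] collapses to a finite
    union over pairs of patterns. *)
Lemma measurable_pattern_event (C : set (set T)) (P0 : set T) (J : finType)
    (Phi : {ffun J -> bool} -> {ffun J -> bool} -> Prop) :
  pattern_measurable C -> measurable P0 ->
  measurable ([set t | exists P, C P /\ Phi (trace P t) (trace P0 t)] : set (box_type T J)).
Proof.
move=> mC mP0.
suff -> : [set t : J -> T | exists P, C P /\ Phi (trace P t) (trace P0 t)] =
    \bigcup_(fg in [set fg | Phi fg.1 fg.2])
     ([set t | exists P, C P /\ forall j, fg.1 j = `[< P (t j) >]] `&`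
      [set t | exists P, [set P0] P /\ forall j, fg.2 j = `[< P (t j) >]]).
  apply: fin_bigcup_measurable => [|fg _]; first exact: finite_finset.
  by apply: measurableI; [exact: mC|exact: pattern_measurable1].
apply/seteqP; split=> t.
  move=> [P [CP PhiP]]; exists (trace P t, trace P0 t) => //.
  by split; [exists P|exists P0]; split=> // j; rewrite ffunE.
move=> [[f g] /= Phifg [[P [CP fP]] [_ [-> gP]]]]; exists P; split=> //.
suff [-> ->] : trace P t = f /\ trace P0 t = g by [].
by split; apply/ffunP => j; rewrite ffunE.
Qed.

End PatternEvents.

(** Since [exp s * exp (- s) = 1], the lower bound [1 - s <= exp (- s)] becomes an upper bound for
    [exp s], and conversely; [s <= 1 / 2] ensures [(1 + s + 2 s^2) (1 - s) >= 1]. *)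
Lemma expR_le_quad {R : realType} (s : R) : 0 <= s <= 2^-1 ->
  expR s <= 1 + s + 2 * s ^+ 2 /\ expR (- s) <= 1 - s + 2 * s ^+ 2.
Proof.
move=> /andP[s0 s1]; have e1 : expR s * expR (- s) = 1 by rewrite -expRD subrr expR0.
have h1 := expR_ge1Dx s; have h2 := expR_ge1Dx (- s).
move: e1 h1 h2; have := expR_gt0 s; have := expR_gt0 (- s).
set a := expR s; set b := expR (- s) => b0 a0 ab a1 b1; rewrite expr2; split.
  have : a * (1 - s) <= (1 + s + 2 * (s * s)) * (1 - s) by nra.
  by rewrite ler_pM2r//; lra.
have : b * (1 + s) <= (1 - s + 2 * (s * s)) * (1 + s) by nra.
by rewrite ler_pM2r//; lra.
Qed.

Definition sample (Omega T : Type) (Z : nat -> Omega -> T) n (w : Omega) : 'I_n -> T :=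
  fun k => Z k w.
Arguments sample {Omega T} Z n w k /.

Definition double_sample (Omega T : Type) (Z : nat -> Omega -> T) n
    (w : Omega * Omega) (j : 'I_n * bool) : T :=
  Z j.1 (if j.2 then w.2 else w.1).
Arguments double_sample {Omega T} Z n w j /.

Section Sampling.
Context d (T : measurableType d) d' (Omega : measurableType d') {R : realType}.
Variables (Q : probability Omega R) (Z : nat -> Omega -> T).
Hypothesis mZ : forall k, measurable_fun setT (Z k).

Definition law (D : set T) : R := fine (Q (Z 0%N @^-1` D)).

(** Independence and identical distribution at once: every factor is the law of [Z 0]. *)
Hypothesis indep : forall n (D : 'I_n -> set T), (forall k, measurable (D k)) ->
  Q [set w | forall k, D k (Z k w)] = (\prod_k law (D k))%:E.

Let mpre (A : set T) : measurable A -> measurable (Z 0%N @^-1` A).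
Proof. by move=> mA; rewrite -[X in measurable X]setTI; exact: mZ. Qed.

Lemma lawID (A B : set T) : measurable A -> measurable B ->
  law A = law (A `&` B) + law (A `&` ~` B).
Proof.
move=> mA mB; rewrite /law -fineD ?fin_num_measure//; last 2 first.
- by apply: mpre; exact: measurableI.
- by apply: mpre; apply: measurableI => //; exact: measurableC.
congr fine; rewrite !preimage_setI preimage_setC.
by rewrite addeC -setDE; apply: measureDI; exact: mpre.
Qed.

Lemma lawT : law setT = 1.
Proof. by rewrite /law preimage_setT [Q _](_ : _ = 1%E)//; exact: probability_setT. Qed.

Lemma law_ge0 A : 0 <= law A.
Proof. exact: fine_ge0. Qed.

Definition count_diff n (f g : {ffun 'I_n -> bool}) : R :=
  \sum_k ((f k)%:R - (g k)%:R).

Lemma measurable_sample n : @measurable_fun _ _ Omega (box_type T 'I_n) setT (sample Z n).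
Proof. by apply: (@measurable_to_boxes _ _ T Omega 'I_n (fun k w => Z k w)) => k; exact: mZ. Qed.

Lemma measurable_sample_event n (C : set (set T)) (P0 : set T)
    (Phi : {ffun 'I_n -> bool} -> {ffun 'I_n -> bool} -> Prop) :
  pattern_measurable C -> measurable P0 ->
  measurable [set w | exists P, C P /\ Phi (trace P (sample Z n w)) (trace P0 (sample Z n w))].
Proof.
move=> mC mP0; have := @measurable_sample n measurableT _
  (measurable_pattern_event (J := 'I_n) Phi mC mP0).
by rewrite setTI.
Qed.

(* Chernoff's bound, with parameter [r / 4]. *)
Lemma count_diff_tail n (P P0 : set T) (r : R) :
  measurable P -> measurable P0 -> 0 < r -> law P + 2 * r <= law P0 ->
  8 <= n%:R * r ^+ 2 ->
  (Q [set w | - (n%:R * r) <= count_diff (trace P (sample Z n w)) (trace P0 (sample Z n w))]%R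
   <= (2^-1)%:E)%E.
Proof.
move=> mP mP0 r0 gap nr.
pose D (x : bool * bool) := (if x.1 then P else ~` P) `&` (if x.2 then P0 else ~` P0).
have mif (b : bool) (A : set T) : measurable A -> measurable (if b then A else ~` A).
  by case: b => // mA; exact: measurableC.
have mD x : measurable (D x) by apply: measurableI; exact: mif.
pose g (x : bool * bool) : R := x.1%:R - x.2%:R.
pose s : R := r / 4.
have s0 : 0 <= s by rewrite divr_ge0// ltW.
have lawP := lawID mP mP0; have lawP0 := lawID mP0 mP.
have lawC := lawID (measurableC mP) mP0; have lawS := lawID measurableT mP.
rewrite lawT !setTI in lawS.
have P0P : law (P0 `&` P) = law (P `&` P0) by rewrite setIC.
have P0P' : law (P0 `&` ~` P) = law (~` P `&` P0) by rewrite setIC.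
have r1 : r <= 2^-1.
  have := law_ge0 P; have := law_ge0 (~` P `&` ~` P0); have := law_ge0 (P `&` ~` P0); lra.
pose m := \sum_x expR (s * g x) * law (D x).
have m0 : 0 <= m by apply: sumr_ge0 => x _; rewrite mulr_ge0 ?expR_ge0 ?law_ge0.
(* The mean of [g] is [law P - law P0 <= - 2 r], and [g ^ 2 <= 1] bounds the quadratic part by
   [2 s ^ 2]. *)
have mle : m <= expR (- (2 * r * s) + 2 * s ^+ 2).
  apply: le_trans (expR_ge1Dx _).
  rewrite /m (eq_bigr (fun x => expR (s * g (x.1, x.2)) * law (D (x.1, x.2)))); last by case.
  rewrite -(pair_bigA _ (fun a b => expR (s * g (a, b)) * law (D (a, b)))) /= !big_bool /=.
  rewrite /g /D /= !subrr !(subr0, sub0r) mulr0 expR0 !mul1r mulr1 mulrN1.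
  have [|e1 e2] := @expR_le_quad _ s; first by rewrite s0 /= /s; lra.
  have a10 := law_ge0 (P `&` ~` P0); have a01 := law_ge0 (~` P `&` P0).
  have := ler_wpM2r a10 e1; have := ler_wpM2r a01 e2.
  have a11 := law_ge0 (P `&` P0); have a00 := law_ge0 (~` P `&` ~` P0).
  have s20 : 0 <= s ^+ 2 by rewrite sqr_ge0.
  move: lawP lawP0 lawC lawS gap a10 a01 a11 a00; rewrite P0P P0P'.
  move: (law P) (law P0) (law (~` P)) (law _) (law _) (law _) (law _) => p p0 pc x y z t.
  move=> h1 h2 h3 h4 h5 h6 h7 h8 h9; nra.
pose E (f : {ffun 'I_n -> bool * bool}) : set Omega :=
  if - (n%:R * r) <= \sum_k g (f k) then [set w | forall k, D (f k) (Z k w)] else set0.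
have mbox (f : {ffun 'I_n -> bool * bool}) : measurable [set w | forall k, D (f k) (Z k w)].
  rewrite [X in measurable X](_ : _ = \bigcap_(k in [set: 'I_n]) (Z k @^-1` D (f k))).
    apply: fin_bigcap_measurable => [|k _]; first exact: finite_finset.
    by rewrite -[X in measurable X]setTI; exact: mZ.
  by apply/seteqP; split=> w /= h k => [_|]; exact: h.
have mE f : measurable (E f) by rewrite /E; case: ifP.
have mA : measurable [set w | - (n%:R * r) <=
    count_diff (trace P (sample Z n w)) (trace P0 (sample Z n w))].
  have := @measurable_sample_event n [set P] P0
    (fun f g => - (n%:R * r) <= count_diff f g) (pattern_measurable1 mP) mP0.
  congr measurable; apply/seteqP; split=> w /=; first by move=> [_ [->]].
  by exists P.
apply: le_trans (measure_le_sum Q mA mE _) _.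
  move=> w /= hw; exists [ffun k : 'I_n => (`[< P (Z k w) >], `[< P0 (Z k w) >])].
  rewrite /E; case: ifPn => [_ k|/negP nE]; last first.
    exfalso; apply: nE; move: hw; congr (_ <= _); apply: eq_bigr => k _.
    by rewrite !ffunE.
  by rewrite ffunE /D /=; split; case: asboolP.
(* Exponential Markov inequality on the finite list of cell patterns: the factor
   [exp (s (n r + sum g))] is at least [1] on the admissible ones, and summing over all patterns
   yields the power [m ^ n]. *)
apply: (@le_trans _ _ (\sum_(f : {ffun 'I_n -> bool * bool}) (expR (s * (n%:R * r)) *
    \prod_k (expR (s * g (f k)) * law (D (f k)))))%:E).
  rewrite -sumEFin; apply: lee_sum => f _; rewrite /E; case: ifPn => [hf|_]; last first.
    rewrite measure0 lee_fin mulr_ge0 ?expR_ge0//; apply: prodr_ge0 => k _.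
    by rewrite mulr_ge0 ?expR_ge0 ?law_ge0.
  rewrite (@indep n (fun k => D (f k)))// lee_fin big_split /= [leRHS]mulrA.
  rewrite -expR_sum -expRD -big_distrr /= -mulrDr.
  rewrite ler_peMl//; first by apply: prodr_ge0 => k _; exact: law_ge0.
  by rewrite -[leLHS]expR0 ler_expR mulr_ge0//; move: hf; set S := \sum_k _; lra.
rewrite lee_fin -big_distrr /=.
rewrite -(bigA_distr_bigA (fun k x => expR (s * g x) * law (D x))) /= prodr_const card_ord.
apply: (@le_trans _ _ (expR (s * (n%:R * r)) * expR (- (2 * r * s) + 2 * s ^+ 2) ^+ n)).
  by rewrite ler_wpM2l ?expR_ge0// lerXn2r// nnegrE ?expR_ge0.
rewrite -expRM_natl -expRD.
(* [s = r / 4] minimizes [- r s + 2 s ^ 2]. The assumption [8 <= n r ^ 2] brings the exponent below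
   [- 1], and [exp (- 1) <= 1 / 2]. *)
have -> : s * (n%:R * r) + n%:R * (- (2 * r * s) + 2 * s ^+ 2) = - (n%:R * r ^+ 2 / 8).
  by rewrite /s; field.
have : expR (- (n%:R * r ^+ 2 / 8)) <= expR (- 1) by rewrite ler_expR; lra.
move=> /le_trans; apply; rewrite expRN lef_pV2 ?posrE ?expR_gt0//.
by have := expR_ge1Dx (1 : R); lra.
Qed.

Definition flip n (s : {ffun 'I_n -> bool}) (j : 'I_n * bool) : 'I_n * bool :=
  (j.1, j.2 (+) s j.1).

Lemma flipK n (s : {ffun 'I_n -> bool}) : involutive (flip s).
Proof. by case=> k b; rewrite /flip /= -addbA addbb addbF. Qed.

Lemma signed_gap_flip n (s : {ffun 'I_n -> bool}) (P : set T) (t : 'I_n * bool -> T) :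
  signed_gap s (trace P t) = signed_gap [ffun=> false] (trace P (t \o flip s)) :> R.
Proof.
apply: eq_bigr => k _; rewrite !ffunE /= /flip /= expr0 mul1r.
by case: (s k); rewrite /= ?expr1 ?expr0 ?mul1r// mulN1r opprB.
Qed.

Lemma measurable_double_sample n (a : 'I_n * bool -> 'I_n * bool) :
  @measurable_fun _ _ (Omega * Omega)%type (box_type T ('I_n * bool)%type) setT
    (fun w => double_sample Z n w \o a).
Proof.
apply: (@measurable_to_boxes _ _ T (Omega * Omega)%type ('I_n * bool)%type
  (fun j w => double_sample Z n w (a j))) => j.
rewrite /double_sample; case: (a j) => k [] /=.
- exact: measurableT_comp (mZ k) (@measurable_snd _ _ _ _).
- exact: measurableT_comp (mZ k) (@measurable_fst _ _ _ _).
Qed.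

Lemma double_sample_box n (D : 'I_n * bool -> set T) : (forall j, measurable (D j)) ->
  ((Q \x Q) [set w | forall j, D j (double_sample Z n w j)] = (\prod_j law (D j))%:E)%E.
Proof.
move=> mD.
have -> : [set w | forall j, D j (double_sample Z n w j)] =
    [set w1 | forall k : 'I_n, D (k, false) (Z k w1)] `*`
    [set w2 | forall k : 'I_n, D (k, true) (Z k w2)].
  apply/seteqP; split=> [[w1 w2] h|[w1 w2] [/= h1 h2] [k []]//].
  by split=> k; [exact: (h (k, false))|exact: (h (k, true))].
have mbox b : measurable [set w | forall k : 'I_n, D (k, b) (Z k w)].
  rewrite [X in measurable X](_ : _ = \bigcap_(k in [set: 'I_n]) (Z k @^-1` D (k, b))).
    apply: fin_bigcap_measurable => [|k _]; first exact: finite_finset.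
    by rewrite -[X in measurable X]setTI; exact: mZ.
  by apply/seteqP; split=> w /= h k => [_|]; exact: h.
have ind b : Q [set w | forall k : 'I_n, D (k, b) (Z k w)] = (\prod_(k < n) law (D (k, b)))%:E.
  exact: (@indep n (fun k => D (k, b))).
transitivity ((\prod_(k < n) law (D (k, false)))%:E * (\prod_(k < n) law (D (k, true)))%:E)%E.
  by rewrite product_measure1E//; congr (_ * _)%E; exact: ind.
rewrite -EFinM -big_split /=; congr (_%:E).
rewrite [RHS](eq_bigr (fun j => law (D (j.1, j.2)))); last by case.
rewrite -(pair_bigA _ (fun k b => law (D (k, b)))) /=.
by apply: eq_bigr => k _; rewrite big_bool mulrC.
Qed.

(** The probability of a box is a product of laws over all entries, hence invariant under permuting
    them, and boxes determine the measure. *)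
Lemma double_sample_exchangeable n (s : {ffun 'I_n -> bool})
    (A : set (box_type T ('I_n * bool)%type)) : measurable A ->
  ((Q \x Q) [set w | A (double_sample Z n w)] =
   (Q \x Q) [set w | A (double_sample Z n w \o flip s)])%E.
Proof.
move=> mA.
pose Q2 : {measure set (Omega * Omega) -> \bar R} := (Q \x Q)%E.
have m1 := measurable_double_sample (n := n) id.
have m2 := measurable_double_sample (flip s).
pose p1 := measure_function_pushforward__canonical__measure_function_Measure Q2 m1.
pose p2 := measure_function_pushforward__canonical__measure_function_Measure Q2 m2.
apply: (@boxes_measure_unique _ T ('I_n * bool)%type R p1 p2) => //.
  rewrite /p1 /= /pushforward preimage_setT [X in (X < _)%E](_ : _ = 1%E) ?ltry//.
  exact: probability_setT.
move=> D mD; rewrite /p1 /p2 /= /pushforward.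
rewrite [LHS](double_sample_box mD).
transitivity ((\prod_j law (D (flip s j)))%:E : \bar R).
  by congr (_%:E); rewrite (reindex_inj (inv_inj (flipK s))).
rewrite -(double_sample_box (D := fun j => D (flip s j)))//; apply: (congr1 Q2).
by apply/seteqP; split=> w h j; have := h (flip s j); rewrite /comp flipK.
Qed.

Section Deviation.
Variables (n : nat) (C : set (set T)) (P0 : set T) (r c : R).
Hypotheses (mC : pattern_measurable C) (mCP : forall P, C P -> measurable P).
Hypotheses (mP0 : measurable P0) (r0 : 0 < r) (nr : 8 <= n%:R * r ^+ 2).
Hypothesis gap : forall P, C P -> law P + 2 * r <= law P0.

Let far (s : {ffun 'I_n -> bool}) (f g : {ffun 'I_n * bool -> bool}) : Prop :=
  n%:R * r <= signed_gap s f - signed_gap s g.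

Let farE s : set (box_type T ('I_n * bool)%type) :=
  [set t | exists P, C P /\ far s (trace P t) (trace P0 t)].

Let beats : set Omega := [set w | exists P, C P /\
  0 <= count_diff (trace P (sample Z n w)) (trace P0 (sample Z n w))].

Lemma measurable_beats : measurable beats.
Proof. exact: (@measurable_sample_event n C P0 (fun f g => 0 <= count_diff f g)). Qed.

Let mfar s : measurable (farE s).
Proof. exact: measurable_pattern_event. Qed.

Let mpull s : measurable [set w | farE s (double_sample Z n w)].
Proof.
have := @measurable_double_sample n id measurableT _ (mfar s).
by rewrite setTI.
Qed.

(** Fix a first sample in [beats] and a witness [P]. The witness does not depend on the ghost
    sample, so [count_diff_tail] applies to it: with probability at least [1 / 2] the ghost count
    falls below [- n r], and the two counts differ by more than [n r]. Integrating over the first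
    sample gives the factor [1 / 2]. *)
Lemma ghost_sample :
  ((2^-1)%:E * Q beats <= (Q \x Q) [set w | farE [ffun=> false] (double_sample Z n w)])%E.
Proof.
set E := [set w | _].
have mE : measurable E by exact: mpull.
have mQ : measurable_fun setT (fun w => Q (xsection E w)) by exact: measurable_fun_xsection.
apply: (@le_trans _ _ (\int[Q]_(w in beats) Q (xsection E w))%E); last first.
  apply: ge0_subset_integral => //; exact: measurable_beats.
rewrite -(integral_cst Q measurable_beats).
apply: ge0_le_integral => //; first exact: measurable_beats.
- by move=> w _; rewrite lee_fin invr_ge0.
- exact: measurable_funTS.
move=> w [P [CP hw]] /=.
pose G := [set w' | - (n%:R * r) <=
  count_diff (trace P (sample Z n w')) (trace P0 (sample Z n w'))].
have mG : measurable G.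
  have := @measurable_sample_event n [set P] P0
    (fun f g => - (n%:R * r) <= count_diff f g) (pattern_measurable1 (mCP CP)) mP0.
  congr measurable; apply/seteqP; split=> w' /=; first by move=> [_ [->]].
  by exists P.
apply: (@le_trans _ _ (Q (~` G))).
  rewrite [leRHS](probability_setC _ mG).
  have := count_diff_tail (mCP CP) mP0 r0 (gap CP) nr; rewrite -/G.
  rewrite -[Q G]fineK ?fin_num_measure// -EFinB !lee_fin; lra.
apply: le_measure; rewrite ?inE.
- exact: measurableC.
- exact: measurable_xsection.
move=> w' /negP; rewrite -ltNge => hw'; rewrite xsectionE; exists P; split=> //.
rewrite /far /signed_gap.
have -> : \sum_k (-1) ^+ [ffun=> false] k *
   ((trace P (double_sample Z n (w, w')) (k, false))%:R -
    (trace P (double_sample Z n (w, w')) (k, true))%:R) -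
  \sum_k (-1) ^+ [ffun=> false] k *
   ((trace P0 (double_sample Z n (w, w')) (k, false))%:R -
    (trace P0 (double_sample Z n (w, w')) (k, true))%:R) =
  count_diff (trace P (sample Z n w)) (trace P0 (sample Z n w)) -
  count_diff (trace P (sample Z n w')) (trace P0 (sample Z n w')) :> R.
  rewrite /count_diff -!sumrB; apply: eq_bigr => k _.
  by rewrite !ffunE /= expr0 !mul1r; lra.
by move: hw' hw; lra.
Qed.

(** The [2 ^ n] swapped events have equal probability, so this probability is an average over swaps,
    bounded by [c] for each fixed double sample; [ghost_sample] costs the factor [2]. *)
Lemma symmetrized_deviation :
  (forall t : 'I_n * bool -> T, #|[set s | `[< exists P, C P /\
      n%:R * r <= signed_gap s (trace P t) - signed_gap s (trace P0 t) >]]%SET|%:R <=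
    2 ^+ n * c) ->
  (Q beats <= (2 * c)%:E)%E.
Proof.
move=> hc.
have sw s : ((Q \x Q) [set w | farE [ffun=> false] (double_sample Z n w)] =
    (Q \x Q) [set w | farE s (double_sample Z n w)])%E.
  rewrite (double_sample_exchangeable s (mfar _)); apply: (congr1 (Q \x Q)%E).
  apply/seteqP; split=> w [P [CP hw]]; exists P; split=> //.
    by rewrite /far !(signed_gap_flip s).
  by rewrite /far -!(signed_gap_flip s).
have := @sum_measure_le _ _ R (Q \x Q)%E {ffun 'I_n -> bool} (2 ^+ n * c)
  (fun s => [set w | farE s (double_sample Z n w)]) mpull.
have hs w : \sum_s \1_[set w | farE s (double_sample Z n w)] w <= 2 ^+ n * c.
  apply: le_trans (hc (double_sample Z n w)).
  rewrite -sum1_card natr_sum [leRHS]big_mkcond /=; apply: ler_sum => s _.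
  rewrite inE indicE; case: (boolP (w \in _)) => [/set_mem h|_]; last by case: ifP.
  by rewrite ifT//; apply/asboolP.
move=> /(_ hs).
rewrite -(eq_bigr _ (fun s _ => sw s)).
have := ghost_sample.
set q2 := ((Q \x Q) _)%E.
pose Q2 : probability (Omega * Omega)%type R := (Q \x Q)%E.
have fq : q2 \is a fin_num by exact: (fin_num_measure Q2 _ (mpull [ffun=> false])).
rewrite -(fineK fq) -[Q beats]fineK ?fin_num_measure//; last exact: measurable_beats.
rewrite -EFinM lee_fin sumEFin sumr_const card_ffun card_bool card_ord !lee_fin.
rewrite -[X in X <= 2 ^+ n * c -> _]mulr_natl natrX ler_pM2l ?exprn_gt0//.
lra.
Qed.

End Deviation.
End Sampling.

(** [B] is the larger of the chaining threshold and the [8] required by the ghost sample. The traced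
    class includes [P0] because the chain starts at its trace. *)
Lemma vc_deviation {R : realType} (v : nat) : exists2 B : R, 0 < B &
  forall d (T : measurableType d) d' (Omega : measurableType d') (Q : probability Omega R)
    (Z : nat -> Omega -> T) n (C : set (set T)) (P0 : set T) (r : R),
  (forall k, measurable_fun setT (Z k)) ->
  (forall n (D : 'I_n -> set T), (forall k, measurable (D k)) ->
    Q [set w | forall k, D k (Z k w)] = (\prod_k law Q Z (D k))%:E) ->
  pattern_measurable C -> (forall P, C P -> measurable P) -> measurable P0 ->
  (forall (J : finType) (t : J -> T),
    vc_le v [set f | `[< exists P, (C P \/ P = P0) /\ f = trace P t >]]%SET) ->
  0 < r -> B <= n%:R * r ^+ 2 ->
  (forall P, C P -> law Q Z P + 2 * r <= law Q Z P0) ->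
  (Q [set w | exists P, C P /\
     (0 <= count_diff (trace P (sample Z n w)) (trace P0 (sample Z n w)) :> R)%R] <=
   (2 * expR (- (n%:R * r ^+ 2 / 1088)))%:E)%E.
Proof.
have [B0 hB0] := chaining (R := R) v; exists (Num.max B0 8); first by rewrite lt_max ltr0n orbT.
move=> d T d' Omega Q Z n C P0 r mZ ind mC mCP mP0 vcC r0.
rewrite ge_max => /andP[nB n8] gap.
have n0 : (0 < n)%N by case: n n8 {nB} => //; rewrite mul0r; lra.
apply: (symmetrized_deviation mZ ind mC mCP mP0 r0 n8 gap) => t.
set F := [set f | `[< exists P, (C P \/ P = P0) /\ f = trace P t >]]%SET.
have P0F : trace P0 t \in F by rewrite inE; apply/asboolP; exists P0; split=> //; right.
apply: le_trans (hB0 n F _ r (vcC _ t) P0F n0 r0 nB).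
rewrite ler_nat; apply: subset_leq_card; apply/fintype.subsetP => s; rewrite !inE.
move=> [P [CP h]]; apply/existsP; exists (trace P t).
rewrite h andbT.
by rewrite inE; apply/asboolP; exists P; split=> //; left.
Qed.

(** * Law of the experiment *)

Section Population.
Context {R : realType} {X : ptopologicalType} (lambda : probability (borel X) R).

Let T := (borel X * borel X)%type.
Let l2 : probability T R := (lambda \x lambda)%E.

Definition flip_pair (z : X * X) : X * X := (z.2, z.1).

Lemma flip_pairK : involutive flip_pair. Proof. by case. Qed.

Lemma measurable_flip_pair : @measurable_fun _ _ T T setT flip_pair.
Proof. exact: (@measurable_swap _ _ (borel X) (borel X)). Qed.

Lemma measurable_preflip (D : set T) : measurable D ->
  measurable (flip_pair @^-1` D : set T).
Proof. by move=> mD; have := measurable_flip_pair measurableT mD; rewrite setTI. Qed.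

Lemma indifferenceE (P : set (X * X)) : indifference P = P `&` flip_pair @^-1` P.
Proof. by apply/seteqP; split=> -[]. Qed.

Lemma measurable_indifference (P : set T) : measurable P ->
  measurable (indifference P : set T).
Proof.
by move=> mP; rewrite indifferenceE; apply: measurableI => //; exact: measurable_preflip.
Qed.

Lemma l2_flip (D : set T) : measurable D -> l2 (flip_pair @^-1` D) = l2 D.
Proof.
move=> mD.
pose p := measure_function_pushforward__canonical__measure_function_Measure
  l2 measurable_flip_pair.
apply/esym; apply: (product_measure_unique (m' := p)) => // A B mA mB.
rewrite /p /= /pushforward.
have -> : flip_pair @^-1` (A `*` B) = B `*` A.
  by apply/seteqP; split=> -[a b] [].
by rewrite muleC; exact: product_measure1E.
Qed.

(** [P] and its mirror image cover the square, overlap in a null set, and have equal measure by the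
    symmetry of [lambda \x lambda]. *)
Lemma l2_complete (P : set T) : measurable P -> (forall z, P z \/ P (flip_pair z)) ->
  l2 (indifference P) = 0%E -> fine (l2 P) = 2^-1.
Proof.
move=> mP cP nP; have mP' := measurable_preflip mP.
have h1 : (l2 (flip_pair @^-1` P) = l2 (~` P))%E.
  have := measureDI l2 mP' mP; rewrite setIC -indifferenceE.
  rewrite [X in (_ + X)%E](_ : _ = 0%E) ?adde0 => [->|]; last exact: nP.
  congr (l2 _); apply/seteqP; split=> z; first by case.
  by move=> nPz; split=> //; case: (cP z).
have := probability_setC l2 mP; rewrite -h1 l2_flip//.
have : l2 P \is a fin_num by exact: fin_num_measure.
by case: (l2 P) => //= p _ [h]; lra.
Qed.

Variables (q : T -> R) (Ps : set T).
Hypotheses (mq : measurable_fun setT q) (q01 : forall z, 0 <= q z <= 1).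
Hypothesis q_strict : forall z, Ps z -> ~ Ps (flip_pair z) -> 2^-1 < q z.
Hypothesis qC : forall z, z.1 <> z.2 -> q (flip_pair z) = 1 - q z.
Hypotheses (mPs : measurable Ps) (cPs : forall z, Ps z \/ Ps (flip_pair z)).
Hypothesis nPs : l2 (indifference Ps) = 0%E.

(* The probability that the problem [(x, y)] falls in [D] and that the choice is
   [x] (if [b]) or [y] (otherwise). *)
Definition choice_mass (b : bool) (D : set T) : \bar R :=
  (\int[l2]_(z in D) (if b then q z else 1 - q z)%:E)%E.

Let mf b (D : set T) : measurable_fun D (fun z => (if b then q z else 1 - q z)%:E : \bar R).
Proof.
apply/measurable_EFinP; apply: measurable_funTS; case: b => //.
by apply: measurable_funB => //; exact: measurable_cst.
Qed.

Let f01 b z : 0 <= (if b then q z else 1 - q z) <= 1.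
Proof. by case: b; have := q01 z; lra. Qed.

Lemma choice_mass_ge0 b (D : set T) : (0 <= choice_mass b D)%E.
Proof. by apply: integral_ge0 => z _; rewrite lee_fin; have /andP[] := f01 b z. Qed.

Lemma choice_mass_le b (D : set T) : measurable D -> (choice_mass b D <= l2 D)%E.
Proof.
move=> mD; rewrite -[leRHS]mul1e -(integral_cst l2 mD); apply: ge0_le_integral => //.
- by move=> z _; rewrite lee_fin; have /andP[] := f01 b z.
- by move=> z _; rewrite lee_fin; have /andP[] := f01 b z.
Qed.

Lemma choice_mass_fin b (D : set T) : measurable D -> choice_mass b D \is a fin_num.
Proof.
move=> mD; rewrite ge0_fin_numE ?choice_mass_ge0//.
by apply: le_lt_trans (choice_mass_le b mD) _; rewrite -ge0_fin_numE// fin_num_measure.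
Qed.

Lemma choice_mass_setU b (A B : set T) : measurable A -> measurable B -> A `&` B = set0 ->
  (choice_mass b (A `|` B) = choice_mass b A + choice_mass b B)%E.
Proof.
move=> mA mB AB; apply: ge0_integral_setU => //.
- by move=> z _; rewrite lee_fin; have /andP[] := f01 b z.
- by rewrite disj_set2E AB.
Qed.

(** Exchange the coordinates and use [q (y, x) = 1 - q (x, y)]. This fails only on the diagonal,
    which completeness of [Ps] places inside its null indifference set. *)
Lemma choice_mass_flip (D : set T) : measurable D ->
  choice_mass false (flip_pair @^-1` D) = choice_mass true D.
Proof.
move=> mD; pose g (z : T) : \bar R := (1 - q (flip_pair z))%:E.
have mg (A : set T) : measurable_fun A g.
  apply/measurable_EFinP; apply: measurable_funTS; apply: measurable_funB => //.
  exact: measurableT_comp mq measurable_flip_pair.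
have g0 z : (0 <= g z)%E by rewrite lee_fin; have := q01 (flip_pair z); lra.
have := @ge0_integral_pushforward _ _ T T R flip_pair measurable_flip_pair l2 D g mD
  (mg D) (fun y _ => g0 y).
have -> : (\int[pushforward l2 (flip_pair : T -> T)]_(y in D) g y = \int[l2]_(y in D) g y)%E.
  apply: eq_measure_integral; first exact: measurable_flip_pair.
  by move=> ? A mA _; exact: (l2_flip mA).
move=> e; transitivity (\int[l2]_(y in D) g y)%E.
  by rewrite e; apply: eq_integral => z _; rewrite /= /g flip_pairK.
apply: ge0_ae_eq_integral => //.
- exact: (mf true).
- by move=> z _; rewrite lee_fin; have /andP[] := q01 z.
exists (indifference Ps); split => //; first exact: measurable_indifference.
move=> [a b]; apply: contra_notP => ni Dz; rewrite /g qC ?opprB 1?addrC ?subrK//= => ab.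
by apply: ni; rewrite /indifference /= ab; have := cPs (a, b); rewrite /flip_pair /= ab; tauto.
Qed.

(** Both relations have measure [1 / 2], so trading [P] minus [Ps] for [Ps] minus [P] preserves
    measure, and [q] is below [1 / 2] on the former and, almost everywhere, above it on the latter.
    This makes the gap [rfun] nonnegative. *)
Lemma choice_mass_max (P : set T) : measurable P -> (forall z, P z \/ P (flip_pair z)) ->
  l2 (indifference P) = 0%E -> (choice_mass true P <= choice_mass true Ps)%E.
Proof.
move=> mP cP nP.
have mI := measurableI _ _ mP mPs.
have mD1 := measurableD mP mPs; have mD2 := measurableD mPs mP.
have mN := measurable_indifference mPs.
have half (D : set T) : measurable D -> (\int[l2]_(x in D) cst (2^-1)%:E x = (2^-1)%:E * l2 D)%E.
  by move=> mD; exact: integral_cst.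
have c1 : (choice_mass true (P `\` Ps) <= (2^-1)%:E * l2 (P `\` Ps))%E.
  rewrite -half//; apply: ge0_le_integral => //.
  - by move=> z _; rewrite lee_fin; have /andP[] := q01 z.
  - exact: (mf true).
  - move=> z [Pz nPz]; rewrite lee_fin.
    have Pfz : Ps (flip_pair z) by case: (cPs z).
    have zd : z.1 <> z.2.
      by case: (z) nPz Pfz => a b; rewrite /flip_pair /= => nPab Pba ab; rewrite ab in nPab Pba.
    have := q_strict Pfz; rewrite flip_pairK => /(_ nPz); rewrite qC//; lra.
pose D2 := (Ps `\` P) `\` indifference Ps.
have mD2' : measurable D2 by exact: measurableD.
have c2 : ((2^-1)%:E * l2 D2 <= choice_mass true (Ps `\` P))%E.
  apply: (@le_trans _ _ (choice_mass true D2)); last first.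
    apply: ge0_subset_integral => //.
    - exact: (mf true).
    - by move=> z _; rewrite lee_fin; have /andP[] := q01 z.
    - by move=> z [].
  rewrite -half//; apply: ge0_le_integral => //.
  - by move=> z _; rewrite lee_fin invr_ge0.
  - exact: (mf true).
  - move=> z [[Pz _] ni]; rewrite lee_fin ltW// q_strict// => Pfz; apply: ni.
    by rewrite /indifference /=; case: (z) Pz Pfz.
have eD2 : l2 (Ps `\` P) = l2 D2.
  rewrite (measureDI l2 mD2 mN) [X in (_ + X)%E](_ : _ = 0%E) ?adde0//.
  apply: (subset_measure0 (mu := l2) _ mN _ nPs); first exact: measurableI.
  exact: subIsetr.
have e1 : choice_mass true P = (choice_mass true (P `&` Ps) + choice_mass true (P `\` Ps))%E.
  rewrite -{1}(setUIDK P Ps); apply: choice_mass_setU => //.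
  by apply/seteqP; split=> z //= [[? ?] []].
have e2 : choice_mass true Ps = (choice_mass true (P `&` Ps) + choice_mass true (Ps `\` P))%E.
  rewrite -{1}(setUIDK Ps P) (setIC Ps P); apply: choice_mass_setU => //.
  by apply/seteqP; split=> z //= [[? ?] []].
have l1 : (l2 P = l2 (P `\` Ps) + l2 (P `&` Ps))%E by exact: measureDI.
have l2' : (l2 Ps = l2 (Ps `\` P) + l2 (P `&` Ps))%E by rewrite (setIC P); exact: measureDI.
have hP := l2_complete mP cP nP; have hPs := l2_complete mPs cPs nPs.
have fin (A : set T) : measurable A -> l2 A = (fine (l2 A))%:E.
  by move=> mA; rewrite fineK// fin_num_measure.
have finc (A : set T) : measurable A -> choice_mass true A = (fine (choice_mass true A))%:E.
  by move=> mA; rewrite fineK// choice_mass_fin.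
move: l1 l2' c1 c2; rewrite -eD2 e1 e2.
rewrite (fin _ mP) (fin _ mPs) (fin _ mD1) (fin _ mD2) (fin _ mI) hP hPs.
rewrite (finc _ mI) (finc _ mD1) (finc _ mD2) -!EFinD -!EFinM !lee_fin.
move=> [h1] [h2]; lra.
Qed.

End Population.

From mathcomp Require Import finmap.

Lemma card_fset_filter (K : choiceType) (s : seq K) (p : pred K) : uniq s ->
  #|` [fset z in seq_fset tt s | p z]%fset | = count p s.
Proof.
move=> us; rewrite -size_filter; apply: perm_size; apply: uniq_perm.
- exact: fset_uniq.
- exact: filter_uniq.
- by move=> z; rewrite mem_filter andbC -(seq_fsetE tt s) !inE.
Qed.

Lemma closed_diagonal {R : realType} (X : topologicalType) :
  completely_metrizable R X -> closed [set z : X * X | z.1 = z.2].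
Proof.
move=> [d [[d0 deq dC dtri] dnbhs _]]; rewrite -openC openE => -[a b] /= ab.
have dab : 0 < d a b.
  by rewrite lt_def d0// andbT; apply/eqP => /(deq a b I I).
exists ([set y | d a y < d a b / 2], [set y | d b y < d a b / 2]).
  by split; apply/dnbhs; exists (d a b / 2); rewrite ?divr_gt0.
move=> [y z] [/= h1 h2] e; move: h2; rewrite -e => h2.
by have := dtri a y b I I I; rewrite (dC y)//; lra.
Qed.

Section Experiment.
Context {R : realType} {X : ptopologicalType} (lambda : probability (borel X) R).
Context {d : measure_display} {Omega : measurableType d} (Q : probability Omega R).
Variables (q : X * X -> R) (x y : nat -> Omega -> X) (c : nat -> Omega -> bool).

Let T := (borel X * borel X)%type.
Let l2 : probability T R := (lambda \x lambda)%E.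

Hypotheses (mx : forall k, measurable_fun setT (x k : Omega -> borel X))
  (my : forall k, measurable_fun setT (y k : Omega -> borel X))
  (mc : forall k, measurable_fun setT (c k)).
Hypotheses (mq : measurable_fun setT (q : T -> R)) (q01 : forall z, 0 <= q z <= 1).
Hypothesis expQ : forall n (D : 'I_n -> set T) (b : 'I_n -> bool),
  (forall k, measurable (D k)) ->
  Q [set w | forall k : 'I_n, D k (x k w, y k w) /\ c k w = b k] =
  (\prod_(k < n) \int[lambda \x lambda]_(z in D k)
    (if b k then q z else 1 - q z)%:E)%E.

Let mass b D := fine (choice_mass lambda q b D).

Lemma measurable_pair k : measurable_fun setT ((fun w => (x k w, y k w)) : Omega -> T).
Proof. exact: measurable_fun_pair. Qed.

(** The law is given for prescribed choices; partition by the vector of choices, then exchange the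
    sum with the product. The sides may thus depend on the choice, as needed for ordering pairs by
    it. *)
Lemma experiment_box n (E : 'I_n -> bool -> set T) : (forall k b, measurable (E k b)) ->
  Q [set w | forall k : 'I_n, E k (c k w) (x k w, y k w)] =
  (\prod_k (mass true (E k true) + mass false (E k false)))%:E.
Proof.
move=> mE; set A := [set w | _].
pose h w : {ffun 'I_n -> bool} := [ffun k : 'I_n => c k w].
have Ah b : A `&` [set w | h w = b] =
    [set w | forall k : 'I_n, E k (b k) (x k w, y k w) /\ c k w = b k].
  apply/seteqP; split=> w.
    by move=> [Aw /= <-] k; split; rewrite ffunE//; exact: Aw.
  move=> hw; split; first by move=> k; have [Ek ck] := hw k; rewrite ck.
  by apply/ffunP => k; rewrite ffunE; have [] := hw k.
have mAh b : measurable (A `&` [set w | h w = b]).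
  rewrite Ah [X in measurable X](_ : _ = \bigcap_(k in [set: 'I_n])
    ((fun w => (x k w, y k w)) @^-1` E k (b k) `&` c k @^-1` [set b k])).
    apply: fin_bigcap_measurable => [|k _]; first exact: finite_finset.
    apply: measurableI.
      by rewrite -[X in measurable X]setTI; exact: measurable_pair.
    by rewrite -[X in measurable X]setTI; exact: mc.
  by apply/seteqP; split=> w hw k; [move=> _|]; exact: hw.
have mA : measurable A.
  rewrite [X in measurable X](_ : _ = \bigcup_(b in [set: {ffun 'I_n -> bool}])
    (A `&` [set w | h w = b])).
    by apply: fin_bigcup_measurable => //; exact: finite_finset.
  by apply/seteqP; split=> w; [move=> Aw; exists (h w)|move=> [b _ []]].
rewrite (measure_partition Q mA mAh).
have -> : \prod_k (mass true (E k true) + mass false (E k false)) =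
    \sum_(b : {ffun 'I_n -> bool}) \prod_k mass (b k) (E k (b k)).
  rewrite -(bigA_distr_bigA (fun k b => mass b (E k b))) /=.
  by apply: eq_bigr => k _; rewrite big_bool.
rewrite -sumEFin; apply: eq_bigr => b _; rewrite Ah.
apply: (etrans (@expQ n (fun k => E k (b k)) b (fun k => mE k (b k)))).
rewrite (big_morph EFin EFinM (erefl _)); apply: eq_bigr => k _.
by rewrite /mass fineK//; apply: (choice_mass_fin lambda mq q01).
Qed.

Definition pick_pair k w : T := chosen_pair x y c w k.

Lemma measurable_pick_pair k : measurable_fun setT (pick_pair k).
Proof.
apply: measurable_fun_ifT; first exact: mc; first exact: measurable_pair.
exact: measurable_fun_pair.
Qed.

Let pmass D := mass true D + mass false (flip_pair @^-1` D).

Lemma pick_pair_box n (D : 'I_n -> set T) : (forall k, measurable (D k)) ->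
  Q [set w | forall k : 'I_n, D k (pick_pair k w)] = (\prod_k pmass (D k))%:E.
Proof.
move=> mD; rewrite -(@experiment_box n (fun k b => if b then D k else flip_pair @^-1` D k)).
  congr (Q _); apply/seteqP; split=> w hw k; have := hw k;
    by rewrite /pick_pair /chosen_pair; case: (c k w).
by move=> k [] //; exact: measurable_preflip.
Qed.

Lemma law_pick_pair (D : set T) : measurable D -> law Q pick_pair D = pmass D.
Proof.
move=> mD; have := @pick_pair_box 1 (fun=> D) (fun=> mD).
rewrite big_ord1 => e; rewrite /law -[RHS]/(fine (pmass D)%:E) -e.
congr (fine (Q _)); apply/seteqP; split=> w.
- by move=> Dw k; rewrite (ord1 k).
- by move=> /(_ ord0).
Qed.

Lemma pick_pair_indep n (D : 'I_n -> set T) : (forall k, measurable (D k)) ->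
  Q [set w | forall k : 'I_n, D k (pick_pair k w)] = (\prod_k law Q pick_pair (D k))%:E.
Proof.
by move=> mD; rewrite pick_pair_box//; congr (_%:E); apply: eq_bigr => k _; rewrite law_pick_pair.
Qed.

End Experiment.

(* [(Z i, Z j)] has the law of two independent copies of the atomless [Z 0]. *)
Lemma collision_null d (T : measurableType d) d' (Omega : measurableType d') {R : realType}
    (Q : probability Omega R) (Z : nat -> Omega -> T) (i j : nat) :
  (forall k, measurable_fun setT (Z k)) ->
  (forall n (D : 'I_n -> set T), (forall k, measurable (D k)) ->
    Q [set w | forall k, D k (Z k w)] = (\prod_k law Q Z (D k))%:E) ->
  measurable [set z : T * T | z.1 = z.2] ->
  (forall z, Q (Z 0%N @^-1` [set z]) = 0%E) ->
  i != j -> measurable [set w | Z i w = Z j w] /\ Q [set w | Z i w = Z j w] = 0%E.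
Proof.
move=> mZ ind mdiag null ij.
have m1 : @measurable_fun _ _ Omega (box_type T bool) setT
    (fun w b => Z (if b then j else i) w).
  apply: (@measurable_to_boxes _ _ T Omega bool (fun b w => Z (if b then j else i) w)) => b.
  exact: mZ.
have m2 : @measurable_fun _ _ (Omega * Omega)%type (box_type T bool) setT
    (fun w b => Z 0%N (if b then w.2 else w.1)).
  apply: (@measurable_to_boxes _ _ T (Omega * Omega)%type bool
    (fun b w => Z 0%N (if b then w.2 else w.1))) => -[].
  - exact: measurableT_comp (mZ 0%N) (@measurable_snd _ _ _ _).
  - exact: measurableT_comp (mZ 0%N) (@measurable_fst _ _ _ _).
pose A : set (box_type T bool) := [set t | t false = t true].
have mcoord b : @measurable_fun _ _ (box_type T bool) T setT (fun t => t b).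
  move=> _ D mD; rewrite setTI; apply: sub_sigma_algebra.
  exists (fun b' => if b' == b then D else setT); split; first by move=> b'; case: ifP.
  apply/seteqP; split=> t /=; first by move=> Dt b'; case: eqP => [->|].
  by move=> /(_ b); rewrite eqxx.
have mA : measurable A.
  have := measurable_fun_pair (mcoord false) (mcoord true) measurableT mdiag.
  by rewrite setTI.
split.
  by have := m1 measurableT _ mA; rewrite setTI.
pose Q2 : probability (Omega * Omega)%type R := (Q \x Q)%E.
pose p1 := measure_function_pushforward__canonical__measure_function_Measure Q m1.
pose p2 := measure_function_pushforward__canonical__measure_function_Measure Q2 m2.
have mpre (D : set T) : measurable D -> measurable (Z 0%N @^-1` D).
  by move=> mD; rewrite -[X in measurable X]setTI; exact: mZ.
suff -> : Q [set w | Z i w = Z j w] = p2 A.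
  rewrite /p2 /= /pushforward /Q2 /= /product_measure1.
  apply: integral0_eq => w _ /=.
  rewrite -[RHS](null (Z 0%N w)); congr (Q _); rewrite xsectionE.
  by apply/seteqP; split=> w'; rewrite /A /= => ->.
apply: (@boxes_measure_unique _ T bool R p1 p2) => //.
  rewrite /p1 /= /pushforward preimage_setT [X in (X < _)%E](_ : _ = 1%E) ?ltry//.
  exact: probability_setT.
move=> D mD; rewrite /p1 /p2 /= /pushforward.
transitivity ((law Q Z (D false) * law Q Z (D true))%:E : \bar R).
  (* Independence is stated for initial segments, so the draws other than [i] and [j] are left
     unconstrained, with factor [1]. *)
  pose n := (maxn i j).+1.
  have iN : (i < n)%N by rewrite ltnS leq_maxl.
  have jN : (j < n)%N by rewrite ltnS leq_maxr.
  pose D' (k : 'I_n) := if k == i :> nat then D false else if k == j :> nat then D true else setT.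
  have mD' k : measurable (D' k) by rewrite /D'; case: ifP => // _; case: ifP.
  transitivity (Q [set w | forall k, D' k (Z k w)]).
    congr (Q _); apply/seteqP; split=> w /= h.
      move=> k; rewrite /D'; case: eqP => [->|_]; first exact: (h false).
      by case: eqP => [->|//]; exact: (h true).
    move=> [|]; first by have := h (Ordinal jN); rewrite /D' /= eq_sym (negbTE ij) eqxx.
    by have := h (Ordinal iN); rewrite /D' /= eqxx.
  rewrite ind//; congr (_%:E).
  rewrite (bigD1 (Ordinal iN))//= (bigD1 (Ordinal jN))/=; last first.
    by rewrite -val_eqE /= eq_sym.
  rewrite big1 ?mulr1; last first.
    move=> k /andP[]; rewrite -!val_eqE /= => ki kj.
    by rewrite /D' (negbTE ki) (negbTE kj) lawT.
  by rewrite /D' /= eqxx eq_sym (negbTE ij) eqxx.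
have -> : (fun (w : Omega * Omega) (b : bool) => Z 0%N (if b then w.2 else w.1)) @^-1`
    [set t | forall b, D b (t b)] = (Z 0%N @^-1` D false) `*` (Z 0%N @^-1` D true).
  by apply/seteqP; split=> [w h|w [h1 h2] []//]; split; [exact: (h false)|exact: (h true)].
apply/esym; apply: etrans (product_measure1E Q Q (mpre _ (mD false)) (mpre _ (mD true))) _.
by rewrite EFinM /law !fineK// fin_num_measure//; exact: mpre.
Qed.

(** * Kemeny minimizers, far preferences and the gap in law *)

(** [chosen] is a finite set, in which a repeated pair would count once; without repetition its
    cardinals are counts over the draws. *)
Lemma kemeny_minimizer_count {R : realType} {X : ptopologicalType} d
    (Omega : measurableType d) (x y : nat -> Omega -> X) (c : nat -> Omega -> bool) n (w : Omega)
    (P P0 : set (X * X)) : (0 < n)%N ->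
  (forall i j, (i < n)%N -> (j < n)%N -> chosen_pair x y c w i = chosen_pair x y c w j -> i = j) ->
  kemeny_loss (R := R) x y c n w P <= kemeny_loss (R := R) x y c n w P0 ->
  0 <= count_diff (R := R) (trace P (sample (fun k w => chosen_pair x y c w k) n w))
         (trace P0 (sample (fun k w => chosen_pair x y c w k) n w)).
Proof.
move=> n0 inj; rewrite /kemeny_loss ler_pM2l ?invr_gt0 ?ltr0n//.
set s := [seq chosen_pair x y c w k | k <- iota 0 n].
have us : uniq s.
  rewrite map_inj_in_uniq ?iota_uniq// => i j; rewrite !mem_iota /= !add0n; exact: inj.
have cnt (A : set (X * X)) : #|` [fset z in chosen x y c n w | ~~ `[< A z >]]%fset |%:R =
    n%:R - \sum_(k < n) (trace A (sample (fun k w => chosen_pair x y c w k) n w) k)%:R :> R.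
  rewrite /chosen card_fset_filter// count_map -sum1_count natr_sum.
  rewrite -[in iota 0 n](subn0 n) -/(index_iota 0 n) big_mkord big_mkcond /=.
  rewrite -[X in X%:R - _](card_ord n) -sum1_card natr_sum -sumrB.
  by apply: eq_bigr => k _; rewrite ffunE /=; case: asboolP => _ /=; rewrite ?subrr ?subr0.
rewrite !cnt /count_diff -[X in 0 <= X]/(\sum_(k < n) _) sumrB; lra.
Qed.

(** If all [2 ^ k] patterns occur on some [k] points, the maximum defining the shatter coefficient
    reaches its top index [2 ^ k], and the VC dimension bounds [k]. *)
Lemma vc_le_traces {X : topologicalType} (PP C : set (set (X * X))) (P0 : set (X * X)) v :
  is_VC_dimension PP v -> C `<=` PP -> PP P0 ->
  forall (J : finType) (t : J -> X * X),
    vc_le v [set f | `[< exists P, (C P \/ P = P0) /\ f = trace P t >]]%SET.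
Proof.
move=> [_ hv] CPP PP0 J t k s hs; apply: hv; apply/eqP; rewrite eqn_leq; apply/andP; split.
  by apply/bigmax_leqP => i _; rewrite -ltnS.
apply: (@leq_trans (@ord_max (2 ^ k))); first by [].
apply: (leq_bigmax_cond (F := fun i : 'I_(2 ^ k).+1 => i : nat)).
apply/asboolP; exists (t \o s) => /=.
rewrite -[RHS](_ : #|{ffun 'I_k -> bool}| = _); last by rewrite card_ffun card_bool card_ord.
rewrite -cardsT; congr #|pred_of_set _|; apply/setP => g; rewrite !inE.
have [f + fg] := hs g; rewrite inE => /asboolP[P [CP fP]].
apply/asboolP; exists P; first by case: CP => [/CPP|->].
by move=> i; rewrite -fg fP ffunE.
Qed.

(** By the triangle inequality, the distance to [P0] passes to the limit. Closedness is what makes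
    trace events of this class measurable. *)
Lemma far_class_closed {R : realType} {X : topologicalType} (PP : set (set (X * X)))
    (rho : set (X * X) -> set (X * X) -> R) (P0 : set (X * X)) (eta : R) :
  (forall P, PP P -> preference P) -> closed_in_closed_convergence PP ->
  compatible_metric rho -> PP P0 ->
  closed_in_closed_convergence [set P | PP P /\ eta <= rho P0 P].
Proof.
move=> prefPP clPP [[rho0 rhoeq rhoC rhotri] comp] PP0 u P uC uP.
have PPP : PP P by apply: clPP uP => n; have [] := uC n.
have prefu n : preference (u n) by apply: prefPP; have [] := uC n.
split=> //; rewrite leNgt; apply/negP => lt.
have /comp := uP => /(_ prefu (prefPP _ PPP)) /cvgrPdist_lt /(_ (eta - rho P0 P)).
rewrite subr_gt0 => /(_ lt)[N _ /(_ N (leqnn _))] /=.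
rewrite sub0r normrN ger0_norm ?rho0//; last exact: prefPP.
rewrite (rhoC _ _ (prefu N) (prefPP _ PPP)).
have [_ le] := uC N.
by have := rhotri P0 P (u N) (prefPP _ PP0) (prefPP _ PPP) (prefu N); lra.
Qed.

Lemma closed_measurable_prod {R : realType} {X : ptopologicalType} (A : set (X * X)) :
  separable X -> completely_metrizable R X -> closed A ->
  measurable (A : set (borel X * borel X)).
Proof.
move=> sep cm cA; have [U bU] := base_of_separable_metrizable sep cm.
have [W [bW mW]] := base_prod bU.
have := @open_measurable_base _ _ (borel X * borel X)%type W id bW mW (~` A) (closed_openC cA).
by move=> /measurableC; rewrite preimage_setC setCK.
Qed.

Section Truth.
Context {R : realType} {X : ptopologicalType} (PP : set (set (X * X)))
  (rho : set (X * X) -> set (X * X) -> R) (lambda : probability (borel X) R)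
  (q : set (X * X) -> X * X -> R) {d : measure_display} {Omega : measurableType d}
  (Pr : set (X * X) -> probability Omega R)
  (x y : nat -> Omega -> X) (c : nat -> Omega -> bool).
Hypotheses (sepX : separable X) (cmX : completely_metrizable R X).
Hypothesis prefPP : forall P, PP P -> preference P.
Hypothesis clPP : closed_in_closed_convergence PP.
Hypothesis compat : compatible_metric rho.
Hypothesis nullPP : forall P, PP P -> (lambda \x lambda)%E (indifference P) = 0%E.
Hypothesis errq : error_probability PP q.
Hypothesis exper : experiment PP lambda q Pr x y c.

Let T := (borel X * borel X)%type.

Lemma measurable_pref P : PP P -> measurable (P : set T).
Proof. by move=> /prefPP[_]; exact: (closed_measurable_prod sepX cmX). Qed.

Lemma complete_flip P : PP P -> forall z, P z \/ P (flip_pair z).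
Proof. by move=> /prefPP[cP _] [a b]; exact: cP. Qed.

Section FixTruth.
Variable Ps : set (X * X).
Hypothesis PPs : PP Ps.

Let mq : measurable_fun setT (q Ps : T -> R). Proof. by have [] := errq PPs. Qed.
Let q01 : forall z, 0 <= q Ps z <= 1. Proof. by have [] := errq PPs. Qed.
Let q_strict z : Ps z -> ~ Ps (flip_pair z) -> 2^-1 < q Ps z.
Proof. by case: z => a b h1 h2; have [_ _ + _] := errq PPs; apply; split. Qed.
Let qC (z : X * X) : z.1 <> z.2 -> q Ps (flip_pair z) = 1 - q Ps z.
Proof. by case: z => a b ab; have [_ _ _] := errq PPs; apply. Qed.

Lemma mu_fin P : PP P -> mu lambda q P Ps \is a fin_num.
Proof. by move=> PPP; apply: (choice_mass_fin lambda mq q01 true); exact: measurable_pref. Qed.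

Lemma mu_le1 : (mu lambda q Ps Ps <= 1)%E.
Proof.
apply: le_trans (choice_mass_le lambda mq q01 true (measurable_pref PPs)) _.
by apply: probability_le1; exact: measurable_pref.
Qed.

Lemma mu_ge0 P : (0 <= mu lambda q P Ps)%E.
Proof. exact: (choice_mass_ge0 lambda q01 true). Qed.

Lemma mu_max P : PP P -> (mu lambda q P Ps <= mu lambda q Ps Ps)%E.
Proof.
move=> PPP; apply: (choice_mass_max mq q01 q_strict qC) => //.
- exact: measurable_pref.
- exact: complete_flip.
- exact: nullPP.
- exact: measurable_pref.
- exact: complete_flip.
- exact: nullPP.
Qed.

Let Z := pick_pair x y c.

Let mx : forall k, measurable_fun setT (x k : Omega -> borel X). Proof. by case: exper. Qed.
Let my : forall k, measurable_fun setT (y k : Omega -> borel X). Proof. by case: exper. Qed.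
Let mc : forall k, measurable_fun setT (c k). Proof. by case: exper. Qed.
Let expQ := let: And4 _ _ _ h := exper in h _ PPs.

(** The chosen pair lies in [P] either in the drawn order or in the reversed one, and
    [choice_mass_flip] equates the two contributions. *)
Lemma law_pref P : PP P -> law (Pr Ps) Z P = 2 * fine (mu lambda q P Ps).
Proof.
move=> PPP; rewrite (law_pick_pair mx my mc mq q01 expQ (measurable_pref PPP)).
rewrite (choice_mass_flip mq q01 qC (measurable_pref PPs) (complete_flip PPs)
  (nullPP PPs) (measurable_pref PPP)).
by rewrite mulr_natl mulr2n.
Qed.

Let mZ k : measurable_fun setT (Z k). Proof. exact: measurable_pick_pair. Qed.

Let indep := pick_pair_indep mx my mc mq q01 expQ.

Let mdiagX : measurable ([set z : X * X | z.1 = z.2] : set T).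
Proof. exact: (closed_measurable_prod sepX cmX (closed_diagonal cmX)). Qed.

(** Completeness puts [(a, a)] in the indifference set, so the square of the mass of [a] vanishes
    and [lambda] has no atom; choice masses are dominated by [lambda \x lambda]. *)
Lemma law_singleton z : Pr Ps (Z 0%N @^-1` [set z]) = 0%E.
Proof.
have m1 (a : X) : measurable ([set a] : set (borel X)).
  have := @measurable_xsection _ _ (borel X) (borel X) _ a mdiagX.
  by congr measurable; rewrite xsectionE; apply/seteqP; split=> b /=.
have l0 (a : X) : lambda [set a] = 0%E.
  have : (lambda [set a] * lambda [set a] = 0)%E.
    rewrite -(product_measure1E lambda lambda (m1 a) (m1 a)).
    have mI := measurable_indifference (measurable_pref PPs).
    apply: (subset_measure0 (mu := (lambda \x lambda)%E) _ mI _ (nullPP PPs)).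
      exact: measurableX.
    move=> [b b'] [/= -> ->]; split => /=; by have [] := complete_flip PPs (a, a).
  by move=> /eqP; rewrite mule_eq0 => /orP[] /eqP.
have mz : measurable ([set z] : set T).
  have -> : [set z] = [set z.1] `*` [set z.2].
    by case: z => a b; apply/seteqP; split=> -[a' b'] /=; [case=> -> ->|case=> -> ->].
  exact: measurableX.
have lz (z' : X * X) (m : measurable ([set z'] : set T)) : (lambda \x lambda)%E [set z'] = 0%E.
  have -> : [set z'] = [set z'.1] `*` [set z'.2].
    by case: z' {m} => a b; apply/seteqP; split=> -[a' b'] /=; [case=> -> ->|case=> -> ->].
  apply: etrans (product_measure1E lambda lambda (m1 _) (m1 _)) _.
  by rewrite [X in (X * _)%E](_ : _ = 0%E) ?mul0e//; exact: l0.
have fz : flip_pair @^-1` [set z] = [set flip_pair z].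
  by apply/seteqP; split=> z' /=; [move=> <-|move=> ->]; rewrite flip_pairK.
have mfz : measurable ([set flip_pair z] : set T) by rewrite -fz; exact: measurable_preflip.
have cm0 b (z' : X * X) : measurable ([set z'] : set T) ->
    fine (choice_mass lambda (q Ps) b [set z']) = 0.
  move=> m; have := choice_mass_le lambda mq q01 b m.
  rewrite [X in (_ <= X)%E](lz _ m) => le; have ge := choice_mass_ge0 lambda q01 b [set z'].
  by rewrite (_ : choice_mass _ _ _ _ = 0%E)//; apply/eqP; rewrite eq_le le.
have := law_pick_pair mx my mc mq q01 expQ mz.
rewrite fz !cm0// addr0 /law => h; apply/eqP.
rewrite -[Pr Ps _]fineK ?fin_num_measure//; first by rewrite h.
by rewrite -[X in measurable X]setTI; exact: mZ.
Qed.

Lemma no_collision i j : i != j ->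
  measurable [set w | Z i w = Z j w] /\ Pr Ps [set w | Z i w = Z j w] = 0%E.
Proof.
move=> ij; apply: (collision_null mZ) => //; last exact: law_singleton.
have -> : [set z : T * T | z.1 = z.2] =
    (fun z : T * T => (z.1.1, z.2.1)) @^-1` [set z | z.1 = z.2] `&`
    (fun z : T * T => (z.1.2, z.2.2)) @^-1` [set z | z.1 = z.2].
  by apply/seteqP; split=> -[[a b] [a' b']] /=; [case=> -> ->|case=> -> ->].
have f1 := @measurable_fst _ _ T T; have f2 := @measurable_snd _ _ T T.
have g1 := @measurable_fst _ _ (borel X) (borel X).
have g2 := @measurable_snd _ _ (borel X) (borel X).
apply: measurableI.
  have := measurable_fun_pair (measurableT_comp g1 f1) (measurableT_comp g1 f2) measurableT mdiagX.
  by rewrite setTI.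
have := measurable_fun_pair (measurableT_comp g2 f1) (measurableT_comp g2 f2) measurableT mdiagX.
by rewrite setTI.
Qed.

End FixTruth.
End Truth.

Lemma inner_probability_ge {R : realType} d (Omega : measurableType d)
    (Q : probability Omega R) (E F : set Omega) :
  measurable F -> F `<=` E -> (Q F <= inner_probability Q E)%E.
Proof. by move=> mF FE; apply: ereal_sup_ubound; exists F. Qed.

(** * The bound on the sample size *)

Theorem theorem3 (R : realType) (X : ptopologicalType)
    (PP : set (set (X * X))) (rho : set (X * X) -> set (X * X) -> R)
    (lambda : probability (borel X) R) (q : set (X * X) -> X * X -> R)
    (d : measure_display) (Omega : measurableType d)
    (Pr : set (X * X) -> probability Omega R)
    (x y : nat -> Omega -> X) (c : nat -> Omega -> bool)
    (est : nat -> Omega -> set (X * X)) :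
  locally_compact [set: X] -> separable X -> completely_metrizable R X ->
  (forall P, PP P -> preference P /\ locally_strict P) ->
  closed_in_closed_convergence PP ->
  compatible_metric rho ->
  full_support lambda ->
  (forall P, PP P -> (lambda \x lambda)%E (indifference P) = 0%E) ->
  error_probability PP q ->
  experiment PP lambda q Pr x y c ->
  kemeny_estimator R PP x y c est ->
  finite_VC_dimension PP ->
  exists K eta0 delta0 : R, [/\ 0 < K, 0 < eta0, 0 < delta0 &
    forall eta delta : R, 0 < eta < eta0 -> 0 < delta < delta0 ->
      (sample_size PP rho Pr est eta delta <=
       K%:E * (rfun PP lambda q rho eta ^+ 2)^-1 * (ln (1 / delta))%:E)%E].
Proof.
move=> _ sepX cmX prefPP' clPP compat _ nullPP errq exper kem [v hv].
have prefPP P : PP P -> preference P by case/prefPP'.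
have [B B0 dev] := vc_deviation (R := R) v.
(* [B] is the threshold of the deviation bound; [2176 = 2 * 1088] turns its exponential into at most
   [delta ^ 2]. *)
pose K := Num.max B 2176.
have K0 : 2176 <= K by rewrite le_max lexx orbT.
have KB : B <= K by rewrite le_max lexx.
(* The factor [2] pays for rounding [M >= 1] up to an integer. Below [exp (- 1)] one has [L >= 1]
   and [delta <= 1 / 2]; any positive [eta0] would do. *)
exists (2 * K), 1, (expR (- 1)); split => //; first by lra.
move=> eta delta _ /andP[delta0 delta1].
set r := rfun _ _ _ _ _; set L := ln (1 / delta).
have LE : L = - ln delta by rewrite /L div1r lnV.
have L1 : 1 <= L.
  by rewrite LE -[leLHS]opprK lerN2 -[leRHS]expRK ler_ln ?posrE ?expR_gt0// ltW.
have deltaE : delta = expR (- L) by rewrite LE opprK lnK.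
have r0 : (0 <= r)%E.
  apply: le_ereal_inf_tmp => _ [P [Ps [PPP PPPs _ ->]]].
  have f1 := mu_fin lambda sepX cmX prefPP errq PPPs PPP.
  have f2 := mu_fin lambda sepX cmX prefPP errq PPPs PPPs.
  rewrite sube_ge0 ?f1//; exact: (mu_max sepX cmX prefPP nullPP errq PPPs PPP).
have L0 : 0 < L by exact: lt_le_trans ltr01 L1.
have K20 : 0 < 2 * K by clear -K0; lra.
have rhs0 : (0 <= (2 * K)%:E * (r ^+ 2)^-1 * L%:E)%E.
  by rewrite !mule_ge0 ?lee_fin ?inve_ge0 ?expe_ge0// ltW.
(* If no two members of [PP] are [eta] apart, the infimum is over the empty set; then [N = 0] works,
   the estimator being always closer than [eta]. *)
have [[P0 [Ps0 [PPP0 PPPs0 far0]]]|none] :=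
    pselect (exists P Ps, [/\ PP P, PP Ps & eta <= rho Ps P]); last first.
  apply: le_trans rhs0; apply: ereal_inf_lbound; exists 0%N => // n _ Ps PPPs.
  apply: le_trans (inner_probability_ge (Pr Ps) (F := setT) measurableT _).
    rewrite [leRHS](_ : _ = 1%E); last exact: probability_setT.
    by rewrite lee_fin; clear -delta0; lra.
  move=> w _ /=; rewrite ltNge; apply/negP => far; apply: none.
  have [PPe _] := kem n w; exists (est n w), Ps; split=> //.
  by have [[_ _ rhoC _] _] := compat; rewrite (rhoC Ps)//; exact: prefPP.
have rle1 : (r <= 1)%E.
  apply: (@le_trans _ _ (mu lambda q Ps0 Ps0 - mu lambda q P0 Ps0)%E).
    by apply: ereal_inf_lbound; exists P0, Ps0.
  have := mu_le1 lambda sepX cmX prefPP errq PPPs0; have := mu_ge0 lambda errq PPPs0 P0.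
  have f1 := mu_fin lambda sepX cmX prefPP errq PPPs0 PPP0.
  have f2 := mu_fin lambda sepX cmX prefPP errq PPPs0 PPPs0.
  rewrite -(fineK f1) -(fineK f2) -EFinB !lee_fin => ge0 le1.
  by apply: le_trans le1; rewrite lerBlDr lerDl.
have rfin : r \is a fin_num by rewrite ge0_fin_numE// (le_lt_trans rle1)// ltry.
have gap P Ps : PP P -> PP Ps -> eta <= rho Ps P -> (r <= mu lambda q Ps Ps - mu lambda q P Ps)%E.
  by move=> PPP PPPs far; apply: ereal_inf_lbound; exists P, Ps.
move: r0 rle1 gap rhs0; rewrite -(fineK rfin).
move: (fine r) => s; rewrite !lee_fin => s0 s1 gap _ {r rfin}.
have [s00|sn0] := eqVneq s 0.
  by rewrite s00 expe2 mule0 inve0 gt0_muley ?lte_fin// gt0_mulye ?leey.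
have {s0 sn0} s0 : 0 < s by rewrite lt_def sn0.
have s20 : 0 < s ^+ 2 by rewrite exprn_gt0.
rewrite -EFin_expe inver gt_eqF// -!EFinM.
pose M := K / s ^+ 2 * L.
have s2M : 1 <= M.
  have i1 : 1 <= (s ^+ 2)^-1 by rewrite invf_ge1// expr_le1// ltW.
  have K1 : 1 <= K by clear -K0; lra.
  by rewrite /M -[leLHS]mulr1 ler_pM// -[leLHS]mulr1 ler_pM.
pose N := (Num.truncn M).+1.
apply: (@le_trans _ _ N%:R%:E); last first.
  rewrite lee_fin /N -natr1.
  have truncM : (Num.truncn M)%:R <= M by rewrite truncn_le (le_trans ler01).
  have -> : 2 * K / s ^+ 2 * L = M + M by rewrite /M -!mulrA mulr_natl mulr2n.
  exact: lerD.
apply: ereal_inf_lbound; exists N => // n Nn Ps PPPs.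
have n0 : (0 < n)%N by apply: leq_trans Nn.
have nM : M <= n%:R.
  by apply: le_trans (ltW (truncnS_gt M)) _; rewrite ler_nat.
have ns : K * L <= n%:R * s ^+ 2.
  by move: nM; rewrite /M mulrAC ler_pdivrMr.
have [mx my mc expall] := exper; have [mq q01 _ _] := errq _ PPPs.
pose Z := pick_pair x y c; pose C := [set P | PP P /\ eta <= rho Ps P].
have mZ k : measurable_fun setT (Z k) by exact: measurable_pick_pair.
have clC : closed_in_closed_convergence C by exact: far_class_closed.
have mPP P : PP P -> measurable (P : set (borel X * borel X)).
  exact: (measurable_pref sepX cmX prefPP).
have [U bU] := base_of_separable_metrizable sepX cmX; have [W [bW mW]] := base_prod bU.
have C0 P : C P -> P !=set0.
  by move=> [/prefPP[cP _] _]; exists (point, point); case: (cP point point).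
have mC : @pattern_measurable _ (borel X * borel X)%type C.
  move=> J f; apply: (measurable_pattern bW mW C0 f clC).
  by move=> P [/prefPP[]].
pose beats := [set w | exists P, C P /\
  0 <= count_diff (R := R) (trace P (sample Z n w)) (trace Ps (sample Z n w))].
have mbeats : measurable beats.
  exact: (measurable_sample_event mZ (fun f g => 0 <= count_diff (R := R) f g) mC (mPP _ PPPs)).
have beats_le : (Pr Ps beats <= delta%:E)%E.
  apply: (@le_trans _ _ (2 * expR (- (n%:R * s ^+ 2 / 1088)))%:E).
    apply: (dev _ _ _ _ (Pr Ps) Z n C Ps s mZ) => //.
    - exact: (pick_pair_indep mx my mc mq q01 (expall _ PPPs)).
    - by move=> P [/mPP].
    - exact: mPP.
    - by apply: vc_le_traces hv _ PPPs => P [].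
    - by apply: le_trans ns; rewrite -[B]mulr1 ler_pM// ltW.
    move=> P [PPP far]; have := gap P Ps PPP PPPs far.
    rewrite (law_pref sepX cmX prefPP nullPP errq exper PPPs PPP).
    rewrite (law_pref sepX cmX prefPP nullPP errq exper PPPs PPPs).
    have f1 := mu_fin lambda sepX cmX prefPP errq PPPs PPP.
    have f2 := mu_fin lambda sepX cmX prefPP errq PPPs PPPs.
    rewrite -(fineK f1) -(fineK f2) -EFinB lee_fin /=.
    by move: (fine _) (fine _) => a b; clear; lra.
  rewrite lee_fin.
  (* The right side is [delta ^ 2]; with [delta <= 1 / 2] the leading factor [2] of the deviation
     bound is absorbed. *)
  have : expR (- (n%:R * s ^+ 2 / 1088)) <= expR (- L) * expR (- L).
    rewrite -expRD ler_expR.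
    have : 2176 * L <= K * L by rewrite ler_wpM2r// ltW.
    by move: ns; clear; lra.
  rewrite -deltaE => h; have dhalf : delta <= 2^-1.
    apply: le_trans (ltW delta1) _; rewrite expRN lef_pV2 ?posrE ?expR_gt0//.
    by have := expR_ge1Dx (1 : R); clear; lra.
  have : delta * delta <= delta * 2^-1 by rewrite ler_wpM2l// ltW.
  by move: h; clear; lra.
pose coll (ij : 'I_n * 'I_n) := if ij.1 != ij.2 then [set w | Z ij.1 w = Z ij.2 w] else set0.
have hcoll ij : measurable (coll ij) /\ Pr Ps (coll ij) = 0%E.
  rewrite /coll; case: ifP => [ij12|_]; last by rewrite measure0; split.
  exact: (no_collision sepX cmX prefPP nullPP errq exper PPPs).
pose colls := \bigcup_(ij in [set: 'I_n * 'I_n]) coll ij.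
have mcolls : measurable colls.
  by apply: fin_bigcup_measurable => [|ij _]; [exact: finite_finset|exact: (hcoll ij).1].
have colls0 : (Pr Ps colls <= 0)%E.
  apply: le_trans (measure_le_sum (Pr Ps) (E := coll) mcolls (fun ij => (hcoll ij).1) _) _.
    by move=> w [ij _]; exists ij.
  by rewrite big1// => ij _; exact: (hcoll ij).2.
(* Off [beats] and the null set of collisions, a far estimator is impossible: as a minimizer it
   would be a witness for [beats]. *)
apply: le_trans (inner_probability_ge (Pr Ps) (F := ~` (beats `|` colls)) _ _).
- rewrite [leRHS](probability_setC (Pr Ps)); last exact: measurableU.
  have : (Pr Ps (beats `|` colls) <= delta%:E)%E.
    apply: le_trans (measureU2 (Pr Ps) mbeats mcolls) _.
    by rewrite -[leRHS]adde0; apply: leeD.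
  have fU : Pr Ps (beats `|` colls) \is a fin_num by apply: fin_num_measure; exact: measurableU.
  by rewrite -(fineK fU) -EFinB !lee_fin; clear; lra.
- by apply: measurableC; exact: measurableU.
move=> w nbc; rewrite /= ltNge; apply/negP => far.
have [PPe mine] := kem n w.
have nb : ~ beats w by move=> bw; apply: nbc; left.
have nc : ~ colls w by move=> cw; apply: nbc; right.
apply: nb; exists (est n w); split.
  by split=> //; have [[_ _ rhoC _] _] := compat; rewrite (rhoC Ps)//; exact: prefPP.
apply: kemeny_minimizer_count => //; last exact: mine.
move=> i j iN jN Zij; apply/eqP; apply/negPn/negP => ij; apply: nc.
exists (Ordinal iN, Ordinal jN) => //; rewrite /coll /= ifT//.
Qed.
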